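(* Let $(X,\mathcal{A},\mu,T)$ be an ergodic probability preserving system, $(A_l)$ an asymptotically rare sequence in $\mathcal{A}$, and $(\psi_{A_l})_{l\ge1}$ a sequence of $\mathfrak{F}$-valued local observables for the $A_l$ such that $\psi_{A_l}\overset{\mu_{A_l}}{\Longrightarrow}\psi$ as $l\to\infty$ for some random element $\psi$ of $\mathfrak{F}$. Let $\Psi_{A_l}$ be the corresponding local processes. Suppose $\mathcal{B}^\pi_{\mathfrak{F}}$ is a $\pi$-system generating the Borel $\sigma$-algebra of $\mathfrak{F}$ with $\mathfrak{F}\in\mathcal{B}^\pi_{\mathfrak{F}}$, and $\Pr[\psi\in\partial F]=0$ for all $F\in\mathcal{B}^\pi_{\mathfrak{F}}$. Let $\nu_l:=\mu_{A_l}$ and assume that for every $F\in\mathcal{B}^\pi_{\mathfrak{F}}$ with $\Pr[\psi\in F]>0$ there are measurable $\tau_{l,F}:X\to\mathbb{N}_0$, $l\ge1$, such that, with $\nu_{l,F}:=(\nu_l)_{\{\psi_{A_l}\in F\}}$, we have $\nu_{l,F}(\tau_{l,F}<\varphi_{A_l})\to1$ as $l\to\infty$, while there is a compact subset $\mathfrak{K}_F$ of $(\mathfrak{P},d_{\mathfrak{P}})$ with $T^{\tau_{l,F}}_\ast\nu_{l,F}\in\mathfrak{K}_F$ for $l\ge1$. Then $$\widetilde\Psi_{A_l}\overset{\mu_{A_l}}{\Longrightarrow}\Psi^\ast\quad\text{and}\quad\Psi_{A_l}\overset{\mu}{\Longrightarrow}\Psi^\ast\qquad\text{as }l\to\infty,$$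 where $\Psi^\ast=(\psi^{\ast(j)})_{j\ge0}$ is an iid sequence in $\mathfrak{F}$ with $\mathrm{law}(\psi^{\ast(0)})=\mathrm{law}(\psi)$. More generally, this conclusion follows if for every $\varepsilon>0$ there are a sequence $(\nu_l)$ in $\mathfrak{P}$ with $d_{\mathfrak{P}}(\nu_l,\mu_{A_l})<\varepsilon$ for all $l$, and, for every $F\in\mathcal{B}^\pi_{\mathfrak{F}}$ with $\Pr[\psi\in F]>0$, a compact set $\mathfrak{K}_F\subseteq\mathfrak{P}$, measures $\nu_{l,F}\in\mathfrak{P}$ with $d_{\mathfrak{P}}(\nu_{l,F},(\nu_l)_{\{\psi_{A_l}\in F\}})\to0$, and measurable $\tau_{l,F}$ such that $\nu_{l,F}(\tau_{l,F}<\varphi_{A_l})\to1$ and $T^{\tau_{l,F}}_\ast\nu_{l,F}\in\mathfrak{K}_F$ for all $l$.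
   Context: $(\mathfrak{F},d_{\mathfrak{F}})$ compact metric space. For $A$ with $\mu(A)>0$: $\varphi_A(x):=\inf\{n\ge1:T^nx\in A\}$, $T_Ax:=T^{\varphi_A(x)}x$, $\mu_A:=\mu(A\cap\cdot)/\mu(A)$; $\nu_B:=\nu(B\cap\cdot)/\nu(B)$. Asymptotically rare: $0<\mu(A_l)\to0$. Local observable: measurable $\psi_A:A\to\mathfrak{F}$; $\Psi_A:=(\psi_A\circ T_A,\psi_A\circ T_A^2,\ldots):X\to\mathfrak{F}^{\mathbb{N}}$ and $\widetilde\Psi_A:=(\psi_A,\psi_A\circ T_A,\ldots):A\to\mathfrak{F}^{\mathbb{N}_0}$. $\mathfrak{P}$: probabilities $\nu\ll\mu$ with $d_{\mathfrak{P}}(\nu,\nu')=2\sup_A|\nu(A)-\nu'(A)|$. $T^\tau x:=T^{\tau(x)}x$, $T^\tau_\ast\nu:=\nu\circ(T^\tau)^{-1}$. $\partial F$ is the topological boundary. $\overset{\nu}{\Longrightarrow}$: weak convergence of laws under $\nu$. *)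

(* Defs.v *)
From HB Require Import structures.
From mathcomp Require Import all_boot all_order all_algebra.
From mathcomp Require Import all_classical all_reals all_analysis.
Set Implicit Arguments.
Unset Strict Implicit.
Unset Printing Implicit Defensive.
Import Order.TTheory GRing.Theory Num.Theory.
Import numFieldNormedType.Exports.
Local Open Scope classical_set_scope.
Local Open Scope ring_scope.

Notation borelT S := (g_sigma_algebraType (@open S)).

Definition boundary (S : topologicalType) (B : set S) : set S :=
  closure B `\` interior B.

Section Dyn.
Context {R : realType} {d : measure_display} {X : measurableType d}.

Definition measure_preserving (mu : set X -> \bar R) (T : X -> X) :=
  measurable_fun setT T /\
  forall B, measurable B -> mu (T @^-1` B) = mu B.

Definition ergodic (mu : set X -> \bar R) (T : X -> X) :=
  forall B, measurable B -> T @^-1` B = B -> mu B = 0%E \/ mu B = 1%E.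

Definition asymptotically_rare (mu : set X -> \bar R) (A : nat -> set X) :=
  (forall l, measurable (A l)) /\ (forall l, (0 < mu (A l))%E) /\
  ((fun l => mu (A l)) @ \oo --> (0 : \bar R)).

(* first return time phi_A; by convention 0 if x never returns to A
   (a mu-null set for ergodic T and mu A > 0) *)
Definition ret_time (T : X -> X) (A : set X) (x : X) : nat :=
  match pselect (exists n, (0 < n)%N && `[< A (iter n T x) >]) with
  | left h => ex_minn h
  | right _ => 0%N
  end.

Definition induced_map (T : X -> X) (A : set X) (x : X) : X :=
  iter (ret_time T A x) T x.

(* the event {tau < phi_A} (phi_A = +oo if x never returns) *)
Definition before_return (T : X -> X) (A : set X) (tau : X -> nat) : set X :=
  [set x | forall n, (0 < n <= tau x)%N -> ~ A (iter n T x)].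

Definition local_process {S : Type} (T : X -> X) (A : set X) (psi : X -> S)
  (x : X) : nat -> S := fun j => psi (iter j.+1 (induced_map T A) x).

Definition local_process0 {S : Type} (T : X -> X) (A : set X) (psi : X -> S)
  (x : X) : nat -> S := fun j => psi (iter j (induced_map T A) x).

Definition condm (nu : set X -> \bar R) (E : set X) : set X -> \bar R :=
  fun B => (nu (E `&` B) * (nu E)^-1)%E.

Definition cond_int (mu : {measure set X -> \bar R}) (A : set X) (g : X -> R)
  : \bar R := ((\int[mu]_(x in A) (g x)%:E) * (mu A)^-1)%E.

Definition push (T : X -> X) (tau : X -> nat) (nu : set X -> \bar R)
  : set X -> \bar R := fun B => nu [set x | B (iter (tau x) T x)].

Definition Probs (mu : set X -> \bar R) : set (set X -> \bar R) :=
  [set nu | [/\ nu set0 = 0%E,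
             (forall B, measurable B -> (0 <= nu B)%E),
             semi_sigma_additive nu,
             nu setT = 1%E &
             (forall B, measurable B -> mu B = 0%E -> nu B = 0%E)]].

Definition dP (nu nu' : set X -> \bar R) : \bar R :=
  (2%:E * ereal_sup [set `|nu B - nu' B|%E | B in measurable])%E.

Definition openP (mu : set X -> \bar R) (U : set (set X -> \bar R)) :=
  U `<=` Probs mu /\
  forall nu, U nu -> exists2 e : R, 0 < e &
    forall nu', Probs mu nu' -> (dP nu nu' < e%:E)%E -> U nu'.

Definition compactP (mu : set X -> \bar R) (K : set (set X -> \bar R)) :=
  K `<=` Probs mu /\
  forall (I : Type) (U : I -> set (set X -> \bar R)),
    (forall i, openP mu (U i)) -> K `<=` \bigcup_i U i ->
    exists2 J : set I, finite_set J & K `<=` \bigcup_(i in J) U i.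

End Dyn.

Definition iid_with_law_of {R : realType} {F : ptopologicalType}
  {dO : measure_display} {Om : measurableType dO} (P' : probability Om R)
  (Y : Om -> nat -> F)
  {dO' : measure_display} {Om' : measurableType dO'} (P : probability Om' R)
  (psi : Om' -> F) :=
  [/\ (forall j, measurable_fun setT ((fun w => Y w j) : Om -> borelT F)),
      (forall j (B : set (borelT F)), measurable B ->
         P' [set w | B (Y w j)] = P (psi @^-1` B)) &
      (forall (s : seq nat) (B : nat -> set (borelT F)), uniq s ->
         (forall j, measurable (B j)) ->
         P' [set w | forall j, j \in s -> B j (Y w j)] =
         (\prod_(j <- s) P' [set w | B j (Y w j)])%E)].

(* Main.v *)
(* Fix a rectangle and let E_l be the event that the local process of A_l lies in
   it.  Up to the return to A_l the local process does not change along an orbit,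
   so E_l and T^-1 E_l differ only inside T^-1 A_l, a set of vanishing measure.
   Comparing a density with its Birkhoff averages, the mean ergodic theorem gives
   nu(E_l) - mu(E_l) -> 0 for every probability nu << mu, and uniformly for nu in
   a compact set.  A delay tau with nu(tau < phi_A) -> 1 does not change nu(E_l)
   asymptotically, so the hypothesis makes E_l and {psi_A in B} asymptotically
   independent under mu_A for all B in the pi-system.  This extends to every
   continuity set B of the law of psi, since \1_B is an L^2-limit of combinations
   of indicators of the pi-system.  With B the whole space, E_l has asymptotically
   the same probability under mu and mu_A; as T_A preserves mu_A, induction on the
   length of the rectangle gives the product limit.  Finally, continuous functions
   on the compact sequence space are uniform limits of combinations of indicators
   of such rectangles. *)
Require Import Defs.
From HB Require Import structures.
From mathcomp Require Import all_boot all_order all_algebra.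
From mathcomp Require Import all_classical all_reals all_analysis.
From mathcomp Require Import measurable_realfun.
From mathcomp Require Import ring lra.
Set Implicit Arguments.
Unset Strict Implicit.
Unset Printing Implicit Defensive.
Import Order.TTheory GRing.Theory Num.Theory.
Import numFieldNormedType.Exports.
Local Open Scope classical_set_scope.
Local Open Scope ring_scope.

(** * Bounded measurable functions and real-valued probabilities *)

Lemma cvg0_approx {R : realType} (u : R^nat) :
  (forall e, 0 < e -> exists2 v : R^nat, v @ \oo --> (0 : R) &
     \forall n \near \oo, `|u n| <= `|v n| + e) ->
  u @ \oo --> (0 : R).
Proof.
move=> uv; apply/cvgr0Pnorm_le => e e0; have e2 : 0 < e / 2 by lra.
have [v /cvgr0Pnorm_le/(_ _ e2) v0 le_uv] := uv _ e2.
by apply: filterS2 v0 le_uv => n vn /le_trans; apply; lra.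
Qed.

Variant indic_spec {R : realType} {Y : Type} (B : set Y) (x : Y) : R -> Prop :=
| IndicIn of B x : indic_spec B x 1
| IndicNotin of ~ B x : indic_spec B x 0.

Lemma indicP {R : realType} {Y : Type} (B : set Y) x :
  indic_spec B x (\1_B x : R).
Proof.
rewrite indicE; case: (boolP (x \in B)) => [/set_mem|/negP nB].
  exact: IndicIn.
by apply: IndicNotin => Bx; apply: nB; exact: mem_set.
Qed.

Lemma indic_in {R : realType} {Y : Type} (B : set Y) x : B x -> \1_B x = 1 :> R.
Proof. by case: indicP. Qed.

Lemma indic_notin {R : realType} {Y : Type} (B : set Y) x :
  ~ B x -> \1_B x = 0 :> R.
Proof. by case: indicP. Qed.

Lemma indic_setC {R : realType} {Y : Type} (B : set Y) x :
  \1_(~` B) x = 1 - \1_B x :> R.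
Proof. by rewrite indicC indicE; case: (_ \in _); rewrite ?subrr ?subr0. Qed.

Lemma measurable_funT_preimage {d d' : measure_display} {Y : measurableType d}
    {Z : measurableType d'} (h : Y -> Z) (B : set Z) :
  measurable_fun setT h -> measurable B -> measurable (h @^-1` B).
Proof. by move=> mh mB; rewrite -[X in measurable X]setTI; exact: mh. Qed.

Lemma measurable_gt_set {R : realType} {d : measure_display}
    {Y : measurableType d} (f : Y -> R) c :
  measurable_fun setT f -> measurable [set x | c < f x].
Proof.
by move=> mf; rewrite -preimage_itvoy; exact: measurable_funT_preimage.
Qed.

Definition bmfun {R : realType} {d : measure_display} {Y : measurableType d}
  (f : Y -> R) := measurable_fun setT f /\ exists M : R, forall x, `|f x| <= M.

Section bmfun.
Context {R : realType} {d : measure_display} {Y : measurableType d}.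
Implicit Types (f g : Y -> R) (B : set Y).

Lemma bmfun_cst (c : R) : bmfun (fun _ : Y => c).
Proof. by split; [exact: measurable_cst|exists `|c|]. Qed.

Lemma bmfunD f g : bmfun f -> bmfun g -> bmfun (fun x => f x + g x).
Proof.
move=> [mf [M fM]] [mg [N gN]]; split; first exact: measurable_funD.
by exists (M + N) => x; rewrite (le_trans (ler_normD _ _))// lerD.
Qed.

Lemma bmfunM f g : bmfun f -> bmfun g -> bmfun (fun x => f x * g x).
Proof.
move=> [mf [M fM]] [mg [N gN]]; split; first exact: measurable_funM.
by exists (M * N) => x; rewrite normrM ler_pM.
Qed.

Lemma bmfunN f : bmfun f -> bmfun (fun x => - f x).
Proof.
move=> [mf [M fM]]; split; first exact: measurableT_comp.
by exists M => x; rewrite normrN.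
Qed.

Lemma bmfunX f n : bmfun f -> bmfun (fun x => f x ^+ n).
Proof.
move=> [mf [M fM]]; split; first exact: measurable_funX.
by exists (M ^+ n) => x; rewrite normrX lerXn2r// nnegrE// (le_trans _ (fM x)).
Qed.

Lemma bmfun_norm f : bmfun f -> bmfun (fun x => `|f x|).
Proof.
move=> [mf [M fM]]; split; first exact: measurableT_comp.
by exists M => x; rewrite normr_id.
Qed.

Lemma bmfun_indic B : measurable B -> bmfun (\1_B : Y -> R).
Proof.
move=> mB; split; first exact: measurable_indic.
by exists 1 => x; case: indicP; rewrite ?normr1 ?normr0.
Qed.

Lemma bmfun_max f g :
  bmfun f -> bmfun g -> bmfun (fun x => Num.max (f x) (g x)).
Proof.
move=> [mf [M fM]] [mg [N gN]]; split; first exact: measurable_maxr.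
exists (Num.max M N) => x; rewrite le_max.
by have [_|_] := leP (f x) (g x); rewrite ?gN ?fM ?orbT.
Qed.

Lemma bmfun_sum (I : Type) (s : seq I) (h : I -> Y -> R) :
  (forall i, bmfun (h i)) -> bmfun (fun x => \sum_(i <- s) h i x).
Proof.
move=> bh; elim: s => [|i s IH].
  by under eq_fun do rewrite big_nil; exact: bmfun_cst.
by under eq_fun do rewrite big_cons; exact: bmfunD.
Qed.

Lemma bmfun_comp {d' : measure_display} {Z : measurableType d'} (f : Y -> R)
  (h : Z -> Y) : bmfun f -> measurable_fun setT h -> bmfun (fun x => f (h x)).
Proof.
by move=> [mf [M fM]] mh; split; [exact: measurableT_comp|exists M].
Qed.

Lemma bmfun_abs_ub f : bmfun f -> exists2 M, 0 <= M & forall x, `|f x| <= M.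
Proof. by move=> [_ [M fM]]; exists M => //; exact: le_trans (fM point). Qed.

Lemma bmfun_uniform_limit f :
  (forall e : R, 0 < e ->
     exists2 g : Y -> R, bmfun g & forall x, `|f x - g x| <= e) ->
  bmfun f.
Proof.
move=> fg; have /choice[g hg] : forall n : nat, exists g : Y -> R, bmfun g /\
    forall x, `|f x - g x| <= n.+1%:R^-1.
  by move=> n; have [|g bg gf] := fg n.+1%:R^-1; [rewrite invr_gt0|exists g].
split.
  apply: (measurable_fun_cvg (h := g)) => [n|x _]; first by case: (hg n) => -[].
  apply/cvgrPdist_le => e e0; near=> n; have [_ /(_ x)/le_trans->//] := hg n.
  by apply: ltW; near: n; exact: near_infty_natSinv_lt (PosNum e0).
have [g0 [_ [C gC]] fg0] := fg 1 ltr01.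
exists (C + 1) => x; rewrite -(subrK (g0 x) (f x)) addrC.
by rewrite (le_trans (ler_normD _ _))// lerD.
Unshelve. all: by end_near.
Qed.

End bmfun.

(* With these hints [//] discharges the boundedness, measurability and, below,
   integrability side conditions. *)
Create HintDb bmfun.
#[local] Hint Resolve bmfun_cst bmfunD bmfunN bmfunM bmfunX bmfun_norm bmfun_indic
  bmfun_max measurableT : bmfun.
#[local] Hint Extern 1 (measurable (_ `&` _)) => apply: measurableI : bmfun.
#[local] Hint Extern 1 (measurable (_ `|` _)) => apply: measurableU : bmfun.
#[local] Hint Extern 1 (measurable (_ `\` _)) => apply: measurableD : bmfun.
#[local] Hint Extern 1 (measurable (_ `+` _)) => apply: measurableU : bmfun.
#[local] Hint Extern 1 (measurable (~` _)) => apply: measurableC : bmfun.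
#[local] Hint Extern 0 (bmfun _) => solve [auto 12 with bmfun nocore] : core.
#[local] Hint Extern 0 (measurable _) => solve [auto 8 with bmfun nocore] : core.

Lemma bounded_fun01 {R : realType} {Y : Type} (f : Y -> R) :
  (forall x, 0 <= f x <= 1) -> bounded_fun f.
Proof.
move=> f01; exists 1; split; first exact: num_real.
move=> M M1 x _ /=; have /andP[f0 f1] := f01 x.
by rewrite ger0_norm// (le_trans f1)// ltW.
Qed.

Lemma continuous_bmfun {R : realType} {F : ptopologicalType} (f : F -> R) :
  continuous f -> bounded_fun f -> bmfun (f : borelT F -> R).
Proof.
move=> cf [B [_ hB]]; split; last first.
  by exists (B + 1) => x; apply: hB => //; rewrite ltrDl.
apply: (measurability _ (RGenOpens.measurableE R)) => _ [_ [a [b ->]] <-].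
rewrite setTI; apply: sub_gen_smallest.
by move/continuousP : cf; apply; exact: interval_open.
Qed.

Definition pr {R : realType} {d : measure_display} {Y : measurableType d}
  (m : set Y -> \bar R) (B : set Y) : R := fine (m B).

Section pr.
Context {R : realType} {d : measure_display} {Y : measurableType d}
  (m : probability Y R).
Implicit Types (f g : Y -> R) (B C : set Y).

Lemma prE B : measurable B -> m B = (pr m B)%:E.
Proof. by move=> mB; rewrite /pr fineK// fin_num_measure. Qed.

Lemma pr_ge0 B : 0 <= pr m B.
Proof. exact: fine_ge0. Qed.

Lemma pr_le1 B : measurable B -> pr m B <= 1.
Proof. by move=> mB; rewrite -lee_fin -prE// probability_le1. Qed.

Lemma pr_setT : pr m setT = 1.
Proof. by rewrite /pr probability_setT. Qed.

Lemma pr_set0 : pr m set0 = 0.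
Proof. by rewrite /pr measure0. Qed.

Lemma le_pr B C : measurable B -> measurable C -> B `<=` C -> pr m B <= pr m C.
Proof.
by move=> mB mC BC; rewrite -lee_fin -!prE// le_measure// inE.
Qed.

Lemma pr_eq0 B C : measurable B -> measurable C -> B `<=` C -> pr m C = 0 ->
  pr m B = 0.
Proof.
move=> mB mC BC C0; apply/eqP; rewrite eq_le pr_ge0 andbT -C0; exact: le_pr.
Qed.

Lemma pr_setU B C : measurable B -> measurable C -> [disjoint B & C] ->
  pr m (B `|` C) = pr m B + pr m C.
Proof.
by move=> mB mC /disj_set2P BC; apply: EFin_inj; rewrite EFinD -!prE// measureU.
Qed.

Lemma pr_setC B : measurable B -> pr m (~` B) = 1 - pr m B.
Proof.
by move=> mB; apply: EFin_inj; rewrite EFinB -!prE// probability_setC.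
Qed.

Lemma pr_setDI B C : measurable B -> measurable C ->
  pr m B = pr m (B `\` C) + pr m (B `&` C).
Proof.
by move=> mB mC; apply: EFin_inj; rewrite EFinD -!prE//; exact: measureDI.
Qed.

Lemma pr_setU_le B C : measurable B -> measurable C ->
  pr m (B `|` C) <= pr m B + pr m C.
Proof. by move=> mB mC; rewrite -lee_fin EFinD -!prE//; exact: measureU2. Qed.

Lemma pr_setI_full B C : measurable B -> measurable C -> pr m B = 1 ->
  pr m (B `&` C) = pr m C.
Proof.
move=> mB mC B1; rewrite [RHS](pr_setDI mC mB) setIC.
by rewrite (@pr_eq0 (C `\` B) (~` B)) ?add0r ?pr_setC ?B1 ?subrr.
Qed.

Lemma dist_pr_setY B C : measurable B -> measurable C ->
  `|pr m B - pr m C| <= pr m (B `+` C).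
Proof.
move=> mB mC; rewrite (pr_setDI mB mC) (pr_setDI mC mB) (setIC C B).
rewrite /setY pr_setU//; last first.
  by apply/disj_set2P; rewrite -subset0 => x [[_ nC] [/nC]].
have := pr_ge0 (B `\` C); have := pr_ge0 (C `\` B).
by rewrite ler_norml => *; apply/andP; split; lra.
Qed.

Lemma pr_nondecreasing_cvg (U : (set Y)^nat) : (forall n, measurable (U n)) ->
  nondecreasing_seq U -> pr m (U n) @[n --> \oo] --> pr m (\bigcup_n U n).
Proof.
move=> mU ndU; have mUU : measurable (\bigcup_n U n) by exact: bigcupT_measurable.
rewrite /pr; apply: fine_cvg; rewrite fineK ?fin_num_measure//.
exact: nondecreasing_cvg_mu.
Qed.

Lemma pr_nonincreasing_cvg (U : (set Y)^nat) : (forall n, measurable (U n)) ->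
  nonincreasing_seq U -> pr m (U n) @[n --> \oo] --> pr m (\bigcap_n U n).
Proof.
move=> mU niU; have mUI : measurable (\bigcap_n U n) by exact: bigcapT_measurable.
rewrite /pr; apply: fine_cvg; rewrite fineK ?fin_num_measure//.
by apply: nonincreasing_cvg_mu => //; rewrite -ge0_fin_numE// fin_num_measure.
Qed.

Lemma bmfun_integrable f : bmfun f -> m.-integrable setT (EFin \o f).
Proof.
move=> [mf [M fM]]; apply: measurable_bounded_integrable => //.
  by rewrite -ge0_fin_numE// fin_num_measure.
exists M; split; first exact: num_real.
by move=> N MN x _ /=; rewrite (le_trans (fM x))// ltW.
Qed.

Lemma Rintegral_prob_cst (c : R) : \int[m]_x c = c.
Proof. by rewrite Rintegral_cst// [fine _]pr_setT mulr1. Qed.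

End pr.
Arguments pr_nondecreasing_cvg {R d Y} m [U].
Arguments pr_nonincreasing_cvg {R d Y} m [U].

#[local] Hint Extern 0 (is_true (integrable _ _ _)) =>
  solve [apply: bmfun_integrable; auto 12 with bmfun nocore] : core.

Lemma Rintegral_indic {R : realType} {d : measure_display}
    {Y : measurableType d} (m : {measure set Y -> \bar R}) (B : set Y) :
  measurable B -> \int[m]_x \1_B x = pr m B.
Proof. by move=> mB; rewrite /Rintegral integral_indic// setIT. Qed.

Lemma Rintegral_sum {R : realType} {d : measure_display}
    {Y : measurableType d} (m : {measure set Y -> \bar R}) (D : set Y)
    (I : Type) (s : seq I) (h : I -> Y -> R) :
  measurable D -> (forall i, m.-integrable D (EFin \o h i)) ->
  \int[m]_(x in D) (\sum_(i <- s) h i x) = \sum_(i <- s) \int[m]_(x in D) h i x.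
Proof.
move=> mD ih; rewrite /Rintegral.
under eq_integral do rewrite -sumEFin.
rewrite integral_sum//= sum_fine// => i _.
exact: integrable_fin_num mD _ (ih i).
Qed.

Lemma dist_Rintegral_le {R : realType} {d : measure_display}
    {Y : measurableType d} (m : probability Y R) (f g : Y -> R) (e : R) :
  bmfun f -> bmfun g -> (forall x, `|f x - g x| <= e) ->
  `|\int[m]_x f x - \int[m]_x g x| <= e.
Proof.
move=> bf bg fg; rewrite -RintegralB// -[e](Rintegral_prob_cst m).
apply: le_trans (le_normr_Rintegral measurableT _) _ => //.
exact: le_Rintegral.
Qed.

Lemma Rintegral_image {R : realType} {d d' : measure_display}
    {Y : measurableType d} {Z : measurableType d'} (m : probability Y R)
    (m' : probability Z R) (h : Y -> Z) (f : Z -> R) :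
  measurable_fun setT h -> (forall B, measurable B -> m (h @^-1` B) = m' B) ->
  bmfun f -> \int[m']_x f x = \int[m]_x f (h x).
Proof.
move=> mh hE bf; have [mf _] := bf; rewrite /Rintegral; congr fine.
transitivity (\int[pushforward m h]_x (f x)%:E)%E.
  by apply: eq_measure_integral => B mB _; exact/esym/hE.
rewrite (integral_pushforward (D := setT) mh)//; first exact/measurable_EFinP.
exact: (bmfun_integrable m (bmfun_comp bf mh)).
Qed.

Lemma integral_bmfun_distribution {R : realType} {d d' : measure_display}
    {Om : measurableType d} {S : measurableType d'} (P : probability Om R)
    (psi : Om -> S) (mpsi : measurable_fun setT psi) (f : S -> R) : bmfun f ->
  (\int[distribution P (mfun_Sub (mem_set mpsi))]_x (f x)%:E =
    \int[P]_w (f (psi w))%:E)%E.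
Proof.
move=> bf; rewrite (integral_distribution (f := EFin \o f))//.
  by apply/measurable_EFinP; case: bf.
exact: (bmfun_integrable P (bmfun_comp bf mpsi)).
Qed.

(** * The mean ergodic theorem *)

Definition birkhoff_sum {R : realType} {X : Type} (T : X -> X) (f : X -> R) n x :=
  \sum_(k < n) f (iter k T x).

Definition birkhoff_avg {R : realType} {X : Type} (T : X -> X) (f : X -> R) n x :=
  n%:R^-1 * birkhoff_sum T f n x.

(* The maximum of the Birkhoff sums of length at most [n], in the recursive
   form that makes the maximal inequality telescope. *)
Fixpoint birkhoff_max {R : realType} {X : Type} (T : X -> X) (f : X -> R) n x : R :=
  if n is n'.+1 then Num.max 0 (f x + birkhoff_max T f n' (T x)) else 0.

Definition birkhoff_positive {R : realType} {X : Type} (T : X -> X)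
    (f : X -> R) n : set X :=
  [set x | 0 < birkhoff_max T f n x].

Definition birkhoff_unbounded {R : realType} {X : Type} (T : X -> X)
    (f : X -> R) : set X :=
  [set x | forall N : nat, exists n, N%:R < birkhoff_sum T f n x].

Section birkhoff_sum.
Context {R : realType} {X : Type} (T : X -> X).
Implicit Types (f : X -> R) (x : X).

Lemma birkhoff_sum0 f x : birkhoff_sum T f 0 x = 0.
Proof. by rewrite /birkhoff_sum big_ord0. Qed.

Lemma birkhoff_sumS f n x :
  birkhoff_sum T f n.+1 x = f x + birkhoff_sum T f n (T x).
Proof.
rewrite /birkhoff_sum big_ord_recl/=; congr (_ + _).
by apply: eq_bigr => i _; rewrite -iterSr.
Qed.

Lemma birkhoff_sumB_cst f c n x :
  birkhoff_sum T (fun y => f y - c) n x = birkhoff_sum T f n x - n%:R * c.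
Proof.
by rewrite /birkhoff_sum sumrB sumr_const card_ord mulr_natl.
Qed.

Lemma ler_norm_birkhoff_sum f (M : R) n x : (forall y, `|f y| <= M) ->
  `|birkhoff_sum T f n x| <= n%:R * M.
Proof.
move=> fM; rewrite (le_trans (ler_norm_sum _ _ _))//.
by rewrite (le_trans (ler_sum _ (fun i _ => fM _)))// sumr_const card_ord mulr_natl.
Qed.

Lemma ler_norm_birkhoff_avg f (M : R) n x : 0 <= M -> (forall y, `|f y| <= M) ->
  `|birkhoff_avg T f n x| <= M.
Proof.
move=> M0 fM; rewrite normrM ger0_norm ?invr_ge0//; case: n => [|n].
  by rewrite birkhoff_sum0 normr0 mulr0.
by rewrite ler_pdivrMl ?ltr0n// ler_norm_birkhoff_sum.
Qed.

Lemma birkhoff_max_ge0 f n x : 0 <= birkhoff_max T f n x.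
Proof. by case: n => //= n; rewrite le_max lexx. Qed.

Lemma birkhoff_max_nondecreasing f n x :
  birkhoff_max T f n x <= birkhoff_max T f n.+1 x.
Proof.
elim: n x => [x|n IH x]; first exact: birkhoff_max_ge0.
by rewrite [leRHS]/= [leLHS]/= le_max2// lerD2l.
Qed.

Lemma birkhoff_sum_le_max f n x : birkhoff_sum T f n x <= birkhoff_max T f n x.
Proof.
elim: n x => [x|n IH x]; first by rewrite birkhoff_sum0.
by rewrite birkhoff_sumS/= le_max lerD2l IH orbT.
Qed.

Lemma birkhoff_unbounded_invariant f (M : R) : (forall x, `|f x| <= M) ->
  T @^-1` birkhoff_unbounded T f = birkhoff_unbounded T f.
Proof.
move=> fM; have [K MK] : exists K : nat, M < K%:R.
  by exists (Num.bound `|M|); rewrite (le_lt_trans (ler_norm M))// archi_boundP.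
have shift x : `|f x| < K%:R := le_lt_trans (fM x) MK.
apply/seteqP; split => x unb N.
  have [n Nn] := unb (N + K)%N; exists n.+1; rewrite birkhoff_sumS.
  by move: Nn (shift x); rewrite natrD ltr_norml => ? /andP[? ?]; lra.
have [[|n]] := unb (N + K)%N; first by rewrite birkhoff_sum0 ltNge ler0n.
rewrite birkhoff_sumS natrD => Nn; exists n.
by move: Nn (shift x); rewrite ltr_norml => ? /andP[? ?]; lra.
Qed.

End birkhoff_sum.

Section measurable_iter.
Context {d : measure_display} {X : measurableType d} (T : X -> X).
Hypothesis mT : measurable_fun setT T.

Lemma measurable_iter k : measurable_fun setT (iter k T).
Proof.
elim: k => [|k IH]; first exact: measurable_id.
exact: (measurableT_comp mT IH).
Qed.

Lemma measurable_iter_preimage k (B : set X) :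
  measurable B -> measurable (iter k T @^-1` B).
Proof. by move=> mB; apply: measurable_funT_preimage => //; exact: measurable_iter. Qed.

End measurable_iter.

Section measure_preserving.
Context {R : realType} {d : measure_display} {X : measurableType d}
  (mu : probability X R) (T : X -> X).
Hypothesis mpT : measure_preserving mu T.
Implicit Types (f w : X -> R) (B : set X).

Let mT : measurable_fun setT T. Proof. by case: mpT. Qed.

Lemma bmfun_iter k f : bmfun f -> bmfun (fun x => f (iter k T x)).
Proof. by move=> bf; apply: (bmfun_comp bf); exact: measurable_iter. Qed.

Lemma bmfun_birkhoff_sum f n : bmfun f -> bmfun (birkhoff_sum T f n).
Proof. by move=> bf; apply: bmfun_sum => k; exact: bmfun_iter. Qed.

Lemma bmfun_birkhoff_avg f n : bmfun f -> bmfun (birkhoff_avg T f n).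
Proof. by move=> /(bmfun_birkhoff_sum n) bs; rewrite /birkhoff_avg. Qed.

Lemma pr_preimage B : measurable B -> pr mu (T @^-1` B) = pr mu B.
Proof. by move=> mB; rewrite /pr; congr fine; exact: mpT.2. Qed.

Lemma pr_preimage_iter k B :
  measurable B -> pr mu (iter k T @^-1` B) = pr mu B.
Proof.
move=> mB; elim: k => [//|k IH].
rewrite -IH -[RHS]pr_preimage; last exact: measurable_iter_preimage.
by congr (pr mu _); apply/seteqP; split => x; rewrite /preimage/= -iterSr.
Qed.

Lemma Rintegral_preserved f : bmfun f -> \int[mu]_x f (T x) = \int[mu]_x f x.
Proof. by move=> bf; rewrite [RHS](Rintegral_image mT mpT.2). Qed.

Lemma Rintegral_iter k f : bmfun f -> \int[mu]_x f (iter k T x) = \int[mu]_x f x.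
Proof.
move=> bf; elim: k => [//|k <-].
under eq_Rintegral do rewrite iterSr.
exact: (Rintegral_preserved (bmfun_iter k bf)).
Qed.

Lemma bmfun_birkhoff_max f n : bmfun f -> bmfun (birkhoff_max T f n).
Proof.
move=> bf; elim: n => [|n IH]; first exact: bmfun_cst.
by apply: bmfun_max => //; apply: bmfunD => //; exact: bmfun_comp.
Qed.

Lemma measurable_birkhoff_positive f n :
  bmfun f -> measurable (birkhoff_positive T f n).
Proof.
by move=> bf; exact/measurable_gt_set/(bmfun_birkhoff_max n bf).1.
Qed.

Lemma maximal_ergodic f n : bmfun f ->
  0 <= \int[mu]_x (\1_(birkhoff_positive T f n) x * f x).
Proof.
move=> bf; have bM k : bmfun (birkhoff_max T f k) by exact: bmfun_birkhoff_max.
have bMT : bmfun (fun x => birkhoff_max T f n (T x)) by exact: bmfun_comp.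
have mE := measurable_birkhoff_positive n bf.
have telescope : \int[mu]_x (birkhoff_max T f n x - birkhoff_max T f n (T x)) = 0.
  by rewrite RintegralB// (Rintegral_preserved (bM n)) subrr.
rewrite -[leLHS]telescope; apply: le_Rintegral => // x _.
rewrite /birkhoff_positive; case: indicP => [/=|/negP];
  rewrite ?mul1r ?mul0r; last first.
  by rewrite -leNgt subr_le0 => /le_trans; apply; exact: birkhoff_max_ge0.
case: n {bM bMT mE telescope} => [|n]; first by rewrite /= ltxx.
have := birkhoff_max_nondecreasing T f n (T x).
move=> /=; set a := birkhoff_max T f n (T x); set b := Num.max _ _.
by move=> ab; case: (leP 0 (f x + a)) => h; lra.
Qed.

Lemma measurable_birkhoff_unbounded f :
  bmfun f -> measurable (birkhoff_unbounded T f).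
Proof.
move=> bf; rewrite (_ : birkhoff_unbounded T f =
    \bigcap_N \bigcup_n [set x | N%:R < birkhoff_sum T f n x]); last first.
  apply/seteqP; split => x /= unb N => [_|].
    by have [n ?] := unb N; exists n.
  by have [n _ ?] := unb N I; exists n.
apply: bigcapT_measurable => N; apply: bigcupT_measurable => n.
exact/measurable_gt_set/(bmfun_birkhoff_sum n bf).1.
Qed.

Hypothesis ergT : ergodic mu T.

Lemma pr_invariant B :
  measurable B -> T @^-1` B = B -> pr mu B = 0 \/ pr mu B = 1.
Proof.
by move=> mB BB; rewrite /pr; have [->|->] := ergT mB BB; [left|right].
Qed.

Lemma Rintegral_ge0_birkhoff_unbounded f : bmfun f ->
  pr mu (birkhoff_unbounded T f) = 1 -> 0 <= \int[mu]_x f x.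
Proof.
move=> bf I1; have mI := measurable_birkhoff_unbounded bf.
have [M _ fM] := bmfun_abs_ub bf.
pose E := birkhoff_positive T f.
have mE n : measurable (E n) by exact: measurable_birkhoff_positive.
have ndE : nondecreasing_seq E.
  apply/nondecreasing_seqP => n; apply/subsetPset => x /= /lt_le_trans; apply.
  exact: birkhoff_max_nondecreasing.
have mU : measurable (\bigcup_n E n) by exact: bigcupT_measurable.
have U1 : pr mu (\bigcup_n E n) = 1.
  apply/eqP; rewrite eq_le pr_le1//= -I1 le_pr// => x /(_ 0%N)[n n_pos].
  by exists n => //=; exact: lt_le_trans n_pos (birkhoff_sum_le_max _ _ _ _).
have cvg0 : M * (1 - pr mu (E n)) @[n --> \oo] --> M * (1 - 1).
  apply: cvgM; [exact: cvg_cst|apply: cvgB; first exact: cvg_cst].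
  by rewrite -U1; exact: pr_nondecreasing_cvg.
rewrite subrr mulr0 in cvg0.
rewrite -oppr_le0; apply: (cvgr_to_ge cvg0); apply: nearW => n /=.
rewrite -pr_setC// -Rintegral_indic// -RintegralZl// lerNl -subr_ge0 opprK.
rewrite -RintegralD//; apply: le_trans (maximal_ergodic n bf) _.
apply: le_Rintegral => // x _; move: (fM x); rewrite ler_norml => /andP[? ?].
by rewrite indic_setC; case: indicP => _; lra.
Qed.

Lemma pr_birkhoff_unbounded f : bmfun f -> \int[mu]_x f x < 0 ->
  pr mu (birkhoff_unbounded T f) = 0.
Proof.
move=> bf; rewrite ltNge => /negP f0; have [M _ fM] := bmfun_abs_ub bf.
have := pr_invariant (measurable_birkhoff_unbounded bf)
  (birkhoff_unbounded_invariant T fM).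
by case=> // /(Rintegral_ge0_birkhoff_unbounded bf).
Qed.

Lemma birkhoff_avg_gt_cvg0 f (e : R) : bmfun f -> 0 < e ->
  pr mu [set x | \int[mu]_y f y + e < birkhoff_avg T f n x]
    @[n --> \oo] --> (0 : R).
Proof.
move=> bf e0; set m := \int[mu]_y f y.
pose g x := f x - (m + e / 2); have bg : bmfun g by rewrite /g.
have bgn n : measurable_fun setT (birkhoff_sum T g n).
  by case: (bmfun_birkhoff_sum n bg).
pose U N := \bigcup_n [set x | N%:R < birkhoff_sum T g n x].
have mU N : measurable (U N).
  by apply: bigcupT_measurable => n; exact: measurable_gt_set.
have niU : nonincreasing_seq U.
  apply/nonincreasing_seqP => N; apply/subsetPset => x [n _ /= Nn].
  by exists n => //=; apply: le_lt_trans Nn; rewrite ler_nat.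
have U0 : pr mu (U N) @[N --> \oo] --> (0 : R).
  rewrite -(pr_birkhoff_unbounded bg); last first.
    by rewrite RintegralB// Rintegral_prob_cst -/m; lra.
  rewrite (_ : birkhoff_unbounded T g = \bigcap_N U N).
    exact: pr_nonincreasing_cvg.
  apply/seteqP; split => x unb N => [_|]; first by have [n] := unb N; exists n.
  by have [n] := unb N I; exists n.
apply/cvgr0Pnorm_le => r r0; have [N UNr] : exists N, pr mu (U N) <= r.
  have /cvgr0Pnorm_le/(_ _ r0)[N _ /(_ N (leqnn N))] := U0.
  by exists N; rewrite -[leLHS]ger0_norm ?pr_ge0.
near=> n; rewrite ger0_norm ?pr_ge0//; apply: le_trans UNr; apply: le_pr => //.
  exact/measurable_gt_set/(bmfun_birkhoff_avg n bf).1.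
have Nn : 2 * N%:R / e < n%:R by near: n; exact: nbhs_infty_gtr.
have n0 : (0 : R) < n%:R by rewrite (le_lt_trans _ Nn)// divr_ge0 ?mulr_ge0// ltW.
move=> x /=; rewrite -(ltr_pM2l n0) mulVKf ?lt0r_neq0// => dev.
exists n => //=; rewrite birkhoff_sumB_cst -/m.
by move: Nn dev; rewrite ltr_pdivrMr// !mulrDr; lra.
Unshelve. all: by end_near.
Qed.

Lemma Rintegral_birkhoff_avg f n : bmfun f -> (0 < n)%N ->
  \int[mu]_x birkhoff_avg T f n x = \int[mu]_x f x.
Proof.
move=> bf n0; have bfk k := bmfun_iter k bf.
rewrite RintegralZl//; last exact/bmfun_integrable/bmfun_birkhoff_sum.
rewrite /birkhoff_sum Rintegral_sum//.
under eq_bigr do rewrite Rintegral_iter//.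
rewrite sumr_const card_ord -[(\int[mu]_x f x) *+ n]mulr_natl mulKf//.
by rewrite pnatr_eq0 -lt0n.
Qed.

Theorem mean_ergodic f : bmfun f ->
  \int[mu]_x `|birkhoff_avg T f n x - \int[mu]_y f y|
    @[n --> \oo] --> (0 : R).
Proof.
move=> bf; set m := \int[mu]_y f y; have [M M0 fM] := bmfun_abs_ub bf.
have mM : `|m| <= M.
  apply: le_trans (le_normr_Rintegral measurableT (bmfun_integrable mu bf)) _.
  rewrite -[leRHS](Rintegral_prob_cst mu).
  by apply: le_Rintegral.
apply: cvg0_approx => e e0; have e2 : 0 < e / 2 by lra.
exists (fun n => 4 * M * pr mu [set x | m + e / 2 < birkhoff_avg T f n x]).
  rewrite -(mulr0 (4 * M)); apply: cvgM; first exact: cvg_cst.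
  exact: birkhoff_avg_gt_cvg0.
exists 1%N => // n n0; rewrite !ger0_norm ?Rintegral_ge0 ?mulr_ge0 ?pr_ge0//.
pose h x := birkhoff_avg T f n x - m.
have ba := bmfun_birkhoff_avg n bf; have bh : bmfun h by rewrite /h.
have mD : measurable [set x | m + e / 2 < birkhoff_avg T f n x].
  exact/measurable_gt_set/ba.1.
have h0 : \int[mu]_x h x = 0.
  by rewrite RintegralB// Rintegral_birkhoff_avg// Rintegral_prob_cst subrr.
rewrite -Rintegral_indic// -RintegralZl//.
rewrite -[X in _ <= _ + X](Rintegral_prob_cst mu) -RintegralD//.
rewrite -[leRHS]subr0 -h0 -RintegralB//; apply: le_Rintegral => // x _.
move: (ler_norm_birkhoff_avg T n x M0 fM) mM.
rewrite -/(h x) !ler_norml => /andP[? ?] /andP[? ?].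
case: indicP => /= [|/negP]; rewrite -?leNgt; case: (ler0P (h x)); rewrite /h; lra.
Qed.

End measure_preserving.

(** * Asymptotically invariant sets *)

Section density.
Context {R : realType} {d : measure_display} {X : measurableType d}
  (mu nu : probability X R).
Import HBNNSimple.

Lemma Rintegral_indicM (B : set X) (f : X -> R) :
  \int[mu]_x (\1_B x * f x) = \int[mu]_(x in B) f x.
Proof.
rewrite [RHS]Rintegral_mkcond; apply: eq_Rintegral => x _.
by rewrite patchE indicE; case: (_ \in _); rewrite ?mul1r ?mul0r.
Qed.

Lemma Rintegral_indicM_setC (B : set X) (f : X -> R) : measurable B -> bmfun f ->
  \int[mu]_x f x = \int[mu]_x (\1_B x * f x) + \int[mu]_x (\1_(~` B) x * f x).
Proof.
move=> mB bf; rewrite -RintegralD//; apply: eq_Rintegral => x _.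
by rewrite indic_setC; ring.
Qed.

Lemma dominated_density_approx (e : R) : nu `<< mu -> 0 < e ->
  exists2 w : X -> R, bmfun w & forall B, measurable B ->
    \int[mu]_x (\1_B x * w x) <= pr nu B <= \int[mu]_x (\1_B x * w x) + e.
Proof.
move=> numu e0; have [f [f0 intf fE]] := radon_nikodym_finite numu.
have f1 : (\int[mu]_x f x = 1)%E by rewrite -fE//; exact: probability_setT.
have [h hf hS] : exists2 h : {nnsfun X >-> R}, (forall x, ((h x)%:E <= f x)%E) &
    ((1 - e)%:E < sintegral mu h)%E.
  have : ((1 - e)%:E < \int[mu]_x f x)%E by rewrite f1 lte_fin; lra.
  by rewrite ge0_integralTE// => /ereal_sup_gt[_ [h hf <-]] ?; exists h.
have bh : bmfun h.
  split => //; have [M [_ hM]] := simple_bounded h.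
  by exists (M + 1) => x; apply: hM => //; rewrite ltrDl.
have h1 : 1 - e < \int[mu]_x h x.
  rewrite -lte_fin (lt_le_trans hS)// -integralT_nnsfun /Rintegral fineK//.
  exact: integrable_fin_num measurableT _ (bmfun_integrable mu bh).
exists h => // B mB.
have lower C : measurable C -> \int[mu]_x (\1_C x * h x) <= pr nu C.
  move=> mC; rewrite Rintegral_indicM -lee_fin -prE// fE// /Rintegral fineK; last first.
    by apply: integrable_fin_num => //; exact: (integrableS measurableT).
  apply: ge0_le_integral => //.
  - by move=> x _; rewrite lee_fin.
  - by apply/measurable_EFinP; apply: measurable_funTS; case: bh.
  - by apply: measurable_funTS; exact: measurable_int intf.
rewrite lower//=; have := lower (~` B); rewrite pr_setC// => /(_ (measurableC mB)).
by move: h1; rewrite (Rintegral_indicM_setC mB bh); lra.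
Qed.

End density.

Definition asymptotically_invariant {R : realType} {d : measure_display}
    {X : measurableType d} (mu : set X -> \bar R) (T : X -> X)
    (E : nat -> set X) :=
  pr mu (E l `+` T @^-1` E l) @[l --> \oo] --> (0 : R).

Section asymptotically_invariant.
Context {R : realType} {d : measure_display} {X : measurableType d}
  (mu : probability X R) (T : X -> X).
Hypothesis mpT : measure_preserving mu T.

Let mT : measurable_fun setT T. Proof. by case: mpT. Qed.

Section one_set.
Variables (w : X -> R) (M : R) (E : set X).
Hypotheses (bw : bmfun w) (wM : forall x, `|w x| <= M) (mE : measurable E).

Let mTE : measurable (T @^-1` E). Proof. exact: measurable_funT_preimage. Qed.

Lemma Rintegral_indic_iter k :
  `|\int[mu]_x (\1_E x * w x) - \int[mu]_x (\1_E x * w (iter k T x))|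
    <= k%:R * (M * pr mu (E `+` T @^-1` E)).
Proof.
have bwk j : bmfun (fun x => w (iter j T x)) := bmfun_iter mpT j bw.
elim: k => [|k IH]; first by rewrite subrr normr0 mul0r.
have shift : `|\int[mu]_x (\1_E x * w (iter k T x)) -
    \int[mu]_x (\1_E x * w (iter k.+1 T x))| <= M * pr mu (E `+` T @^-1` E).
  rewrite -(Rintegral_preserved mpT (bmfunM (bmfun_indic mE) (bwk k))).
  under eq_Rintegral do rewrite -iterSr.
  have bET : bmfun (fun x => \1_E (T x) : R) by exact: bmfun_comp.
  rewrite -RintegralB//; apply: le_trans (le_normr_Rintegral measurableT _) _ => //.
  rewrite -Rintegral_indic// -RintegralZl//; apply: le_Rintegral => // x _.
  rewrite -mulrBl normrM mulrC ler_pM ?indic_ge0//.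
  case: (indicP E x) => Ex; case: (indicP E (T x)) => ETx; rewrite ?subrr ?normr0//.
    by rewrite sub0r normrN normr1 indic_in//; left.
  by rewrite subr0 normr1 indic_in//; right.
rewrite -natr1 mulrDl mul1r (le_trans (ler_distD _ _ _) (lerD IH shift))//.
Qed.

Lemma Rintegral_indic_birkhoff_avg n : (0 < n)%N ->
  `|\int[mu]_x (\1_E x * w x) - \int[mu]_x (\1_E x * birkhoff_avg T w n x)|
    <= n%:R * (M * pr mu (E `+` T @^-1` E)).
Proof.
rewrite -(ltr0n R) => n0; set b := M * _.
have bwk j : bmfun (fun x => w (iter j T x)) := bmfun_iter mpT j bw.
set a := \int[mu]_x (\1_E x * w x).
have -> : \int[mu]_x (\1_E x * birkhoff_avg T w n x) =
    n%:R^-1 * \sum_(k < n) \int[mu]_x (\1_E x * w (iter k T x)).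
  rewrite -Rintegral_sum// -RintegralZl//; last first.
    exact/bmfun_integrable/bmfun_sum.
  by apply: eq_Rintegral => x _; rewrite mulrCA mulr_sumr.
have -> : a = n%:R^-1 * \sum_(k < n) a.
  by rewrite sumr_const card_ord -[a *+ n]mulr_natl mulKf// lt0r_neq0.
rewrite -mulrBr -sumrB normrM gtr0_norm ?invr_gt0// ler_pdivrMl//.
rewrite (le_trans (ler_norm_sum _ _ _))//.
have b0 : 0 <= b by rewrite mulr_ge0 ?pr_ge0// (le_trans _ (wM point)).
apply: (@le_trans _ _ (\sum_(k < n) n%:R * b)); last first.
  by rewrite sumr_const card_ord -[leLHS]mulr_natl.
apply: ler_sum => k _; apply: le_trans (Rintegral_indic_iter k) _.
by rewrite ler_wpM2r// ler_nat ltnW.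
Qed.

End one_set.

Hypothesis ergT : ergodic mu T.
Variable E : nat -> set X.
Hypotheses (mE : forall l, measurable (E l)) (invE : asymptotically_invariant mu T E).

Lemma asymptotically_invariant_Rintegral w : bmfun w ->
  \int[mu]_x (\1_(E l) x * w x) - pr mu (E l) * \int[mu]_x w x @[l --> \oo] --> (0 : R).
Proof.
move=> bw; have [M M0 wM] := bmfun_abs_ub bw; set m := \int[mu]_x w x.
apply: cvg0_approx => e e0.
have [n n0 hn] : exists2 n, (0 < n)%N & \int[mu]_x `|birkhoff_avg T w n x - m| <= e.
  have /cvgr0Pnorm_le/(_ _ e0)[n _ le_n] := mean_ergodic mpT ergT bw.
  exists n.+1 => //; have := le_n n.+1 (leqnSn n).
  by rewrite ger0_norm// Rintegral_ge0.
have ba := bmfun_birkhoff_avg mpT n bw.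
exists (fun l => n%:R * (M * pr mu (E l `+` T @^-1` E l))).
  rewrite -(mulr0 n%:R) -[X in _ * X](mulr0 M).
  by apply: cvgM; [exact: cvg_cst|apply: cvgM => //; exact: cvg_cst].
apply: nearW => l; have mEl := mE l.
rewrite [X in _ <= X + _]ger0_norm ?mulr_ge0 ?pr_ge0//.
set b := \int[mu]_x (\1_(E l) x * birkhoff_avg T w n x).
apply: le_trans (ler_distD b _ _) _; apply: lerD.
  exact: Rintegral_indic_birkhoff_avg.
apply: le_trans hn; rewrite -Rintegral_indic// -RintegralZr// -RintegralB//.
apply: le_trans (le_normr_Rintegral measurableT _) _ => //.
apply: le_Rintegral => // x _; rewrite -mulrBr normrM.
by case: indicP => _; rewrite ?normr1 ?normr0 ?mul1r ?mul0r.
Qed.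

Theorem asymptotically_invariant_dominated (nu : probability X R) : nu `<< mu ->
  pr nu (E l) - pr mu (E l) @[l --> \oo] --> (0 : R).
Proof.
move=> numu; apply: cvg0_approx => e e0.
have [w bw wE] := dominated_density_approx numu e0.
exists (fun l => \int[mu]_x (\1_(E l) x * w x) - pr mu (E l) * \int[mu]_x w x).
  exact: asymptotically_invariant_Rintegral.
apply: nearW => l; set v := _ - pr mu (E l) * _; have mEl := mE l.
have /andP[lower upper] := wE _ mEl.
have := wE _ measurableT; rewrite pr_setT.
rewrite (_ : \int[mu]_x (\1_setT x * w x) = \int[mu]_x w x); last first.
  by apply: eq_Rintegral => x _; rewrite indicT mul1r.
move=> /andP[m_le1 m_ge]; rewrite ler_norml.
have := ler_norm v; have := ler_norm (- v); rewrite normrN.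
have := pr_ge0 mu (E l); have := pr_le1 mu mEl.
by rewrite {1 3}/v => *; apply/andP; split; nra.
Qed.

End asymptotically_invariant.

(** * Compact families of absolutely continuous probabilities *)

Section Probs_probability.
Context {R : realType} {d : measure_display} {X : measurableType d}
  (mu nu : set X -> \bar R).
Hypothesis Pnu : Probs mu nu.

(* A [measure] must be nonnegative on all sets, [Probs] only constrains the
   measurable ones. *)
Definition measure_of_Probs (_ : Probs mu nu) (B : set X) : \bar R :=
  if `[< measurable B >] then nu B else 0%E.

Let m := measure_of_Probs Pnu.

Let mE B : measurable B -> m B = nu B.
Proof. by move=> mB; rewrite /m /measure_of_Probs asboolT. Qed.

Let m0 : m set0 = 0%E. Proof. by rewrite mE//; case: Pnu. Qed.

Let m_ge0 B : (0 <= m B)%E.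
Proof.
rewrite /m /measure_of_Probs; case: ifPn => // /asboolP mB.
by case: Pnu => _ /(_ _ mB).
Qed.

Let m_sigma : semi_sigma_additive m.
Proof.
move=> B mB tB mU; rewrite mE//; case: Pnu => _ _ /(_ B mB tB mU) + _ _.
by under eq_fun do under eq_bigr do rewrite -mE//.
Qed.

HB.instance Definition _ :=
  isMeasure.Build _ _ _ (measure_of_Probs Pnu) m0 m_ge0 m_sigma.

Let mT : measure_of_Probs Pnu setT = 1%E.
Proof. by rewrite -[LHS]/(m setT) mE//; case: Pnu. Qed.

HB.instance Definition _ :=
  Measure_isProbability.Build _ _ _ (measure_of_Probs Pnu) mT.

Lemma Probs_probability : exists2 p : probability X R,
  (forall B, measurable B -> nu B = p B) &
  (forall B, measurable B -> mu B = 0%E -> p B = 0%E).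
Proof.
exists (measure_of_Probs Pnu) => B mB; first by rewrite -mE.
by move=> B0; rewrite -[LHS]/(m B) mE//; case: Pnu => _ _ _ _; exact.
Qed.

End Probs_probability.

Lemma filter_bigcap_finite {Y : Type} {I : choiceType} (J : set I)
    (f : I -> set Y) (F : set_system Y) : Filter F -> finite_set J ->
  (forall i, J i -> F (f i)) -> F (\bigcap_(i in J) f i).
Proof. by move=> FF /finite_fsetP[D ->] FfD; exact: filter_bigI. Qed.

Lemma pr_eq {R : realType} {d : measure_display} {X : measurableType d}
    (nu nu' : set X -> \bar R) (B : set X) :
  (forall C, measurable C -> nu C = nu' C) -> measurable B -> pr nu B = pr nu' B.
Proof. by move=> nuE mB; rewrite /pr nuE. Qed.

Section Probs.
Context {R : realType} {d : measure_display} {X : measurableType d}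
  (mu : probability X R).
Implicit Types (p q r : set X -> \bar R) (B : set X).

Lemma Probs_of_probability (m : probability X R) p :
  (forall B, measurable B -> p B = m B) ->
  (forall B, measurable B -> mu B = 0%E -> m B = 0%E) -> Probs mu p.
Proof.
move=> pE mac; split.
- by rewrite pE// measure0.
- by move=> B mB; rewrite pE.
- move=> B mB tB mU; rewrite pE//.
  under eq_fun do under eq_bigr do rewrite pE//.
  exact: measure_semi_sigma_additive.
- by rewrite pE// probability_setT.
- by move=> B mB mu0; rewrite pE// mac.
Qed.

Lemma Probs_self : Probs mu mu. Proof. exact: (@Probs_of_probability mu). Qed.

Lemma Probs_prE p B : Probs mu p -> measurable B -> p B = (pr p B)%:E.
Proof.
by move=> /Probs_probability[m mp _] mB; rewrite (pr_eq mp)// mp// -prE.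
Qed.

Lemma dP_ge0 p q : (0 <= dP p q)%E.
Proof.
rewrite mule_ge0//; apply: (@le_trans _ _ `|p set0 - q set0|%E).
  exact: abse_ge0.
by apply: ereal_sup_ubound; exists set0.
Qed.

Lemma dist_pr_le_dP p q B : Probs mu p -> Probs mu q -> measurable B ->
  ((2 * `|pr p B - pr q B|)%:E <= dP p q)%E.
Proof.
move=> Pp Pq mB; rewrite EFinM lee_pmul2l//; apply: ereal_sup_ubound.
by exists B => //; rewrite (Probs_prE Pp)// (Probs_prE Pq).
Qed.

Lemma dist_pr_lt_dP p q B (e : R) : Probs mu p -> Probs mu q -> measurable B ->
  (dP p q < e%:E)%E -> `|pr p B - pr q B| < e.
Proof.
move=> Pp Pq mB; have := dist_pr_le_dP Pp Pq mB.
move=> /le_lt_trans/[apply]; rewrite lte_fin.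
by have := normr_ge0 (pr p B - pr q B); lra.
Qed.

Lemma dP_triangle p q r : Probs mu p -> Probs mu q -> Probs mu r ->
  (dP p r <= dP p q + dP q r)%E.
Proof.
move=> Pp Pq Pr; rewrite {1}/dP muleC -lee_pdivlMr//; apply: ge_ereal_sup.
move=> _ [B mB <-]; rewrite lee_pdivlMr// muleC.
apply: le_trans (leeD (dist_pr_le_dP Pp Pq mB) (dist_pr_le_dP Pq Pr mB)).
rewrite (Probs_prE Pp)// (Probs_prE Pr)// -EFinB abse_EFin -EFinM -EFinD lee_fin.
by rewrite -mulrDr ler_pM2l// ler_distD.
Qed.

Lemma dPxx p : Probs mu p -> dP p p = 0%E.
Proof.
move=> Pp; rewrite /dP (_ : [set _ | B in measurable] = [set 0%E]).
  by rewrite ereal_sup1 mule0.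
have pB0 B : measurable B -> `|p B - p B|%E = 0%E.
  by move=> mB; rewrite (Probs_prE Pp)// -EFinB subrr abse_EFin normr0.
apply/seteqP; split => [_ [B /pB0 pB <-]//|_ ->].
by exists set0 => //; exact: pB0.
Qed.

Lemma openP_ball p (e : R) : Probs mu p ->
  openP mu [set q | Probs mu q /\ (dP p q < e%:E)%E].
Proof.
move=> Pp; split => [q []//|q [Pq pq]].
have fpq : dP p q \is a fin_num.
  by rewrite ge0_fin_numE ?dP_ge0// (lt_trans pq) ?ltry.
exists (e - fine (dP p q)); first by rewrite subr_gt0 -lte_fin fineK.
move=> r Pr qr; split => //; apply: (le_lt_trans (dP_triangle Pp Pq Pr)).
by rewrite addeC -lteBrDr// -{1}(fineK fpq) -EFinB.
Qed.

Lemma compactP_cover (K : set (set X -> \bar R)) (e : R) : compactP mu K -> 0 < e ->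
  exists2 J : set (set X -> \bar R), finite_set J & J `<=` Probs mu /\
    forall q, K q -> exists2 p, J p & (dP p q < e%:E)%E.
Proof.
move=> [KP cK] e0; pose U (p : {p | Probs mu p}) : set (set X -> \bar R) :=
  [set q | Probs mu q /\ (dP (sval p) q < e%:E)%E].
have [J fJ KJ] : exists2 J : set {p | Probs mu p}, finite_set J &
    K `<=` \bigcup_(p in J) U p.
  apply: cK => [p|q Kq]; first by apply: openP_ball; exact: svalP.
  have Pq := KP _ Kq; exists (exist _ q Pq) => //; split => //=.
  by rewrite dPxx.
exists (sval @` J); first exact: finite_image.
split=> [_ [p _ <-]|q /KJ[p Jp [_ pq]]]; first exact: svalP.
by exists (sval p) => //; exists p.
Qed.

Lemma compactP_cvg (K : set (set X -> \bar R)) (q : nat -> set X -> \bar R)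
    (E : nat -> set X) (c : R^nat) :
  compactP mu K -> (forall l, K (q l)) -> (forall l, measurable (E l)) ->
  (forall p : probability X R, p `<< mu ->
     pr p (E l) - c l @[l --> \oo] --> (0 : R)) ->
  pr (q l) (E l) - c l @[l --> \oo] --> (0 : R).
Proof.
move=> cK Kq mE cvg_p; apply/cvgr0Pnorm_le => e e0.
have e2 : 0 < e / 2 by lra.
have [J finJ [JP coverJ]] := compactP_cover cK e2.
have near_J : \forall l \near \oo, forall p, J p -> `|pr p (E l) - c l| <= e / 2.
  apply: (@filter_bigcap_finite _ _ J (fun p l => `|pr p (E l) - c l| <= e / 2)) => //.
  move=> p Jp; have [m pE mac] := Probs_probability (JP _ Jp).
  have /cvgr0Pnorm_le/(_ _ e2) : pr m (E l) - c l @[l --> \oo] --> (0 : R).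
    by apply: cvg_p; exact/null_content_dominatesP.
  by apply: filterS => l /=; rewrite (pr_eq pE).
apply: filterS near_J => l near_l; have [p Jp pq] := coverJ _ (Kq l).
have near_q := dist_pr_lt_dP (JP _ Jp) (cK.1 _ (Kq l)) (mE l) pq.
rewrite distrC in near_q; rewrite [leRHS]splitr.
by rewrite (le_trans (ler_distD (pr p (E l)) _ _))// lerD ?near_l// ltW.
Qed.

End Probs.

(** * Conditioning, and integrals off null sets *)

Section integral_off_null.
Context {R : realType} {d : measure_display} {X : measurableType d}
  (mu : {measure set X -> \bar R}) (N : set X).
Hypotheses (mN : measurable N) (N0 : mu N = 0%E).
Import HBNNSimple.

(* The integrands need not be measurable: the local processes evaluate [psi_A]
   outside of [A] at the points that never return to [A]. *)
Lemma ge0_le_integral_off_null (f g : X -> \bar R) : (forall x, 0 <= f x)%E ->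
  (forall x, 0 <= g x)%E -> (forall x, ~ N x -> f x <= g x)%E ->
  (\int[mu]_x f x <= \int[mu]_x g x)%E.
Proof.
move=> f0 g0 fg; rewrite !ge0_integralTE//; apply: ge_ereal_sup => _ [h hf <-].
have [h' h'E] : exists h' : {nnsfun X >-> R}, forall x, h' x = (h \_ (~` N)) x.
  by exists (proj_nnsfun h (measurableC mN)) => x; rewrite -mrestrict.
have -> : sintegral mu h = sintegral mu h'.
  rewrite -!integralT_nnsfun (ge0_negligible_integral mN measurableT _ _ N0)//=.
  - rewrite setTD integral_mkcond; apply: eq_integral => x _.
    by rewrite h'E !patchE; case: ifP.
  - exact/measurable_EFinP.
  - by move=> x _; rewrite lee_fin.
apply: ereal_sup_ubound; exists h' => // x.
rewrite h'E patchE; case: ifPn => // /set_mem Nx.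
exact: le_trans (hf x) (fg _ Nx).
Qed.

Lemma eq_integral_off_null (f g : X -> \bar R) :
  (forall x, ~ N x -> f x = g x) -> (\int[mu]_x f x = \int[mu]_x g x)%E.
Proof.
move=> fg; rewrite integralE [RHS]integralE.
congr (_ - _)%E; apply/eqP; rewrite eq_le; apply/andP; split;
  by apply: ge0_le_integral_off_null => // x Nx; rewrite ?funeposE ?funenegE fg.
Qed.

End integral_off_null.

Lemma integral_EFin_full {R : realType} {d : measure_display}
    {X : measurableType d} (m : probability X R) (V : set X) (f g : X -> R) :
  measurable V -> pr m V = 1 -> (forall x, V x -> f x = g x) -> bmfun g ->
  (\int[m]_x (f x)%:E = (\int[m]_x g x)%:E)%E.
Proof.
move=> mV V1 fg bg; have mVC : measurable (~` V) by [].
rewrite (@eq_integral_off_null _ _ _ m _ mVC _ _ (EFin \o g)).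
- by rewrite /Rintegral fineK//; exact: integrable_fin_num.
- by rewrite [LHS](prE m mVC) pr_setC// V1 subrr.
- by move=> x /contrapT /fg ->.
Qed.

Definition conditional {R : realType} {d : measure_display}
    {X : measurableType d} (m : probability X R) (S : set X)
    (mS : measurable S) : probability X R :=
  mnormalize (mrestr m mS) m.

Section conditional.
Context {R : realType} {d : measure_display} {X : measurableType d}
  (m : probability X R) (S : set X) (mS : measurable S).
Hypothesis S0 : 0 < pr m S.
Implicit Types (B : set X) (f : X -> R).

Lemma conditionalE B : measurable B ->
  conditional m mS B = ((pr m S)^-1 * pr m (S `&` B))%:E.
Proof.
move=> mB; rewrite /conditional /= /mnormalize /= /mrestr setTI.
rewrite (prE m mS) eqe gt_eqF//= setIC prE//.
by rewrite -EFinM mulrC.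
Qed.

Lemma pr_conditional B : measurable B ->
  pr (conditional m mS) B = (pr m S)^-1 * pr m (S `&` B).
Proof. by move=> mB; rewrite {1}/pr conditionalE. Qed.

Lemma pr_conditional_setI B : measurable B ->
  pr (conditional m mS) (S `&` B) = pr (conditional m mS) B.
Proof.
by move=> mB; rewrite !pr_conditional ?setIA ?setIid//; exact: measurableI.
Qed.

Lemma condm_conditional B : measurable B -> condm m S B = conditional m mS B.
Proof.
move=> mB; rewrite conditionalE// /condm !prE//.
by rewrite inver gt_eqF// -EFinM mulrC.
Qed.

Lemma conditional_eq0 B : measurable B -> m B = 0%E -> conditional m mS B = 0%E.
Proof.
move=> mB B0; have prB0 : pr m B = 0 by rewrite /pr B0.
by rewrite conditionalE// (pr_eq0 _ mB (@subIsetr _ S B) prB0) ?mulr0.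
Qed.

Let ge0_Rintegral_conditional f : bmfun f -> (forall x, 0 <= f x) ->
  \int[conditional m mS]_x f x = (pr m S)^-1 * \int[m]_x (\1_S x * f x).
Proof.
move=> bf f0; have k0 : 0 <= (pr m S)^-1 by rewrite invr_ge0 ltW.
have [mf _] := bf; have mfE : measurable_fun setT (EFin \o f) by exact/measurable_EFinP.
rewrite Rintegral_indicM /Rintegral -[X in X * _]/(fine (_)%:E) -fineM//; last first.
  by apply: integrable_fin_num => //; exact: (integrableS measurableT).
congr fine.
rewrite (ge0_negligible_integral (measurableC mS) measurableT)//; last 2 first.
- by move=> x _; rewrite lee_fin.
- by rewrite [LHS]conditionalE// setICr pr_set0 mulr0.
rewrite setTD setCK.
rewrite -[RHS](@ge0_integral_mscale _ _ _ m S mS (NngNum k0))//; last 2 first.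
- exact: measurable_funTS.
- by move=> x _; rewrite lee_fin.
apply: eq_measure_integral => B mB BS.
by rewrite [LHS]conditionalE// (setIidr BS) EFinM -prE.
Qed.

Lemma Rintegral_conditional f : bmfun f ->
  \int[conditional m mS]_x f x = (pr m S)^-1 * \int[m]_x (\1_S x * f x).
Proof.
move=> bf; have [M M0 fM] := bmfun_abs_ub bf.
have fM0 x : 0 <= f x + M by move: (fM x); rewrite ler_norml => /andP[]; lra.
have := ge0_Rintegral_conditional (bmfunD bf (bmfun_cst M)) fM0.
under [in RHS]eq_Rintegral do rewrite mulrDr.
rewrite !RintegralD// Rintegral_prob_cst RintegralZr// Rintegral_indic//.
by rewrite mulrDr (mulrA _ (pr m S)) mulVf ?lt0r_neq0// mul1r => /addIr.
Qed.

Lemma cond_int_conditional (V : set X) (f g : X -> R) :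
  measurable V -> pr m V = 1 -> (forall x, S x -> V x -> f x = g x) -> bmfun g ->
  cond_int m S f = (\int[conditional m mS]_x g x)%:E.
Proof.
move=> mV V1 fg bg; rewrite Rintegral_conditional// /cond_int integral_mkcond.
rewrite restrict_EFin (integral_EFin_full (g := fun x => \1_S x * g x) mV V1)//.
  by rewrite [X in (_ * X^-1)%E](prE m mS) inver gt_eqF// -EFinM mulrC.
move=> x Vx; rewrite patchE; case: indicP => Sx.
  by rewrite mem_set// mul1r fg.
by rewrite memNset// mul0r.
Qed.

End conditional.

Lemma condm_neq0 {R : realType} {d : measure_display} {X : measurableType d}
    (nu : set X -> \bar R) (S : set X) : condm nu S setT = 1%E -> nu S <> 0%E.
Proof.
move=> + S0; rewrite /condm setIT S0 mul0e => /esym/eqP.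
by rewrite eqe oner_eq0.
Qed.

Lemma Probs_condm {R : realType} {d : measure_display} {X : measurableType d}
    (mu : probability X R) (nu : set X -> \bar R) (S : set X) :
  Probs mu nu -> measurable S -> 0 < pr nu S -> Probs mu (condm nu S).
Proof.
move=> /Probs_probability[p pE pac] mS; rewrite (pr_eq pE)// => S0.
apply: (@Probs_of_probability _ _ _ _ (conditional p mS)) => B mB.
  by rewrite -condm_conditional// /condm !pE.
by move=> B0; apply: conditional_eq0 => //; exact: pac.
Qed.

Lemma pr_condm {R : realType} {d : measure_display} {X : measurableType d}
    (mu : probability X R) (nu : set X -> \bar R) (S B : set X) :
  Probs mu nu -> measurable S -> measurable B -> 0 < pr nu S ->
  pr (condm nu S) B = (pr nu S)^-1 * pr nu (S `&` B).
Proof.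
move=> /Probs_probability[p pE _] mS mB; rewrite !(pr_eq pE)// => S0.
by rewrite -pr_conditional// /pr -condm_conditional// /condm !pE.
Qed.

(** * Linear spans of indicators and their density *)

Inductive lspan {R : realType} {Y : Type} (G : set (set Y)) : (Y -> R) -> Prop :=
| lspan_indic B : G B -> lspan G \1_B
| lspan_lin a b f g : lspan G f -> lspan G g ->
    lspan G (fun x => a * f x + b * g x).

Section lspan.
Context {R : realType} {Y : Type} (G : set (set Y)).
Implicit Types f g : Y -> R.

Lemma lspanZ a f : lspan G f -> lspan G (fun x => a * f x).
Proof.
move=> Gf; rewrite (_ : (fun x => _) = (fun x => a * f x + 0 * f x)).
  exact: lspan_lin.
by apply/funext => x; ring.
Qed.

Lemma lspanD f g : lspan G f -> lspan G g -> lspan G (fun x => f x + g x).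
Proof.
move=> Gf Gg; rewrite (_ : (fun x => _) = (fun x => 1 * f x + 1 * g x)).
  exact: lspan_lin.
by apply/funext => x; ring.
Qed.

Lemma lspanB f g : lspan G f -> lspan G g -> lspan G (fun x => f x - g x).
Proof.
move=> Gf Gg; rewrite (_ : (fun x => _) = (fun x => 1 * f x + (-1) * g x)).
  exact: lspan_lin.
by apply/funext => x; ring.
Qed.

Lemma lspan_cst (c : R) : G setT -> lspan G (fun=> c).
Proof.
move=> GT; rewrite (_ : (fun=> c) = (fun x => c * \1_setT x)).
  by apply: lspanZ; exact: lspan_indic.
by apply/funext => x; rewrite indicT mulr1.
Qed.

Lemma lspanM f g : setI_closed G -> lspan G f -> lspan G g ->
  lspan G (fun x => f x * g x).
Proof.
move=> GI; elim=> [B GB|a b f1 f2 _ IH1 _ IH2] Gg.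
  elim: Gg => [C GC|a b g1 g2 _ IH1 _ IH2].
    rewrite (_ : (fun x => _) = \1_(B `&` C)); last by rewrite indicI.
    by apply: lspan_indic; exact: GI.
  rewrite (_ : (fun x => _) =
      (fun x => a * (\1_B x * g1 x) + b * (\1_B x * g2 x))).
    exact: lspan_lin.
  by apply/funext => x; ring.
rewrite (_ : (fun x => _) = (fun x => a * (f1 x * g x) + b * (f2 x * g x))).
  by apply: lspan_lin; [exact: IH1|exact: IH2].
by apply/funext => x; ring.
Qed.

Lemma lspanS (H : set (set Y)) f : G `<=` H -> lspan G f -> lspan H f.
Proof.
move=> GH; elim=> [B GB|a b f1 f2 _ IH1 _ IH2]; last exact: lspan_lin.
by apply: lspan_indic; exact: GH.
Qed.

Lemma lspan_cvg0 (Lam : nat -> (Y -> R) -> R) f :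
  (forall l a b g h, lspan G g -> lspan G h ->
    Lam l (fun x => a * g x + b * h x) = a * Lam l g + b * Lam l h) ->
  (forall B, G B -> Lam l \1_B @[l --> \oo] --> (0 : R)) ->
  lspan G f -> Lam l f @[l --> \oo] --> (0 : R).
Proof.
move=> lin G0; elim=> [B /G0//|a b f1 f2 G1 IH1 G2 IH2].
rewrite (_ : (fun l => _) = (fun l => a * Lam l f1 + b * Lam l f2)).
  rewrite [0 in X in _ --> X](_ : 0 = a * 0 + b * 0); last by rewrite !mulr0 addr0.
  by apply: cvgD; apply: cvgM => //; exact: cvg_cst.
by apply/funext => l; rewrite lin.
Qed.

Lemma lspan_piecewise {I : eqType} (s : seq I) (V : I -> set Y) (c : I -> R)
    f (e : R) : setI_closed G -> G setT ->
  (forall i, G (V i)) -> (forall i x, V i x -> `|f x - c i| <= e) ->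
  exists2 g, lspan G g &
    forall x, (exists2 i, i \in s & V i x) -> `|f x - g x| <= e.
Proof.
move=> GI GT GV fV; elim: s => [|i s [g Gg fg]].
  by exists (fun=> 0); [exact: lspan_cst|move=> x []].
exists (fun x => c i * \1_(V i) x + (1 - \1_(V i) x) * g x).
  have Gi : lspan G (\1_(V i) : Y -> R) by exact: lspan_indic.
  apply: lspanD; first exact: lspanZ.
  by apply: lspanM => //; apply: lspanB => //; exact: lspan_cst.
move=> x [j]; rewrite in_cons => js Vj; case: indicP => [Vi|nVi].
  by rewrite mulr1 subrr mul0r addr0; exact: fV.
rewrite mulr0 add0r subr0 mul1r; apply: fg.
by case/predU1P : js Vj => [->//|js] Vj; exists j.
Qed.

End lspan.

Lemma compact_seq_cover {Y : topologicalType} (K : set Y) (V : Y -> set Y) :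
  compact K -> (forall y, K y -> nbhs y (V y)) ->
  exists s : seq Y, K `<=` [set x | exists2 y, y \in s & V y x].
Proof.
move=> /compact_near_coveringP cK nV; pose supseqs : set_system (seq Y) :=
  filter_from setT (fun s : seq Y => [set s' : seq Y | {subset s <= s'}]).
have supseqs_filter : Filter supseqs.
  apply: filter_from_filter => [|s1 s2 _ _]; first by exists [::].
  by exists (s1 ++ s2) => // s sub; split=> z zs; apply: sub;
    rewrite mem_cat zs ?orbT.
have [s _ covs] : \forall s \near supseqs, K `<=` [set x | exists2 y, y \in s & V y x].
  apply: (cK _ supseqs (fun s x => exists2 y, y \in s & V y x)) => y Ky.
  exists (V y, [set s : seq Y | y \in s]).
    split; first exact: nV.
    by exists [:: y] => // s; apply; rewrite mem_head.
  by move=> [x s] [/= Vx ys]; exists y.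
by exists s; exact: covs.
Qed.

Lemma lspan_uniform_dense {R : realType} {Y : topologicalType}
    (G : set (set Y)) (f : Y -> R) (e : R) :
  compact [set: Y] -> setI_closed G -> G setT ->
  (forall (y : Y) U, nbhs y U -> exists V, [/\ G V, nbhs y V & V `<=` U]) ->
  continuous f -> 0 < e ->
  exists2 g, lspan G g & forall y, `|f y - g y| <= e.
Proof.
move=> cY GI GT Gnbhs cf e0.
have /choice[V hV] : forall y : Y, exists V, [/\ G V, nbhs y V &
    forall z, V z -> `|f z - f y| <= e].
  move=> y; have : nbhs y [set z | `|f z - f y| <= e].
    have /cvgrPdist_le/(_ e e0) := cf y.
    by apply: filterS => z; rewrite distrC.
  by move=> /Gnbhs[V [GV yV VU]]; exists V.
have [s covs] : exists s : seq Y, [set: Y] `<=` [set x | exists2 y, y \in s & V y x].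
  by apply: compact_seq_cover cY _ => y _; case: (hV y).
have [g Gg fg] := @lspan_piecewise _ _ _ _ s V f f e GI GT
  (fun y => let: And3 GV _ _ := hV y in GV)
  (fun y => let: And3 _ _ Ve := hV y in Ve).
by exists g => // y; apply: fg; exact: covs.
Qed.

Lemma indic_setU_disjoint {R : realType} {Y : Type} (B C : set Y) x :
  B `&` C = set0 -> \1_(B `|` C) x = \1_B x + \1_C x :> R.
Proof.
move=> BC0; case: (indicP B x) => Bx; case: (indicP C x) => Cx.
- by have : (B `&` C) x by []; rewrite BC0.
- by rewrite addr0 indic_in//; left.
- by rewrite add0r indic_in//; right.
- by rewrite addr0 indic_notin// => -[].
Qed.

Section L2_closure.
Context {R : realType} {d : measure_display} {Y : measurableType d}
  (M : probability Y R) (G : set (set Y)).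
Hypothesis mG : G `<=` measurable.
Implicit Types (f g : Y -> R) (B : set Y).

Lemma lspan_bmfun f : lspan G f -> bmfun f.
Proof.
by elim=> [B /mG mB|a b f1 f2 _ ? _ ?]; [exact: bmfun_indic|].
Qed.

Definition L2_closure f := forall e : R, 0 < e ->
  exists2 g, lspan G g & \int[M]_x ((f x - g x) ^+ 2) <= e.

Lemma lspan_L2_closure f : lspan G f -> L2_closure f.
Proof.
move=> Gf e e0; exists f => //.
under eq_Rintegral do rewrite subrr expr0n/=.
by rewrite Rintegral_prob_cst ltW.
Qed.

Lemma Rintegral_sqrD_le f g : bmfun f -> bmfun g ->
  \int[M]_x ((f x + g x) ^+ 2) <=
  2 * \int[M]_x (f x ^+ 2) + 2 * \int[M]_x (g x ^+ 2).
Proof.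
move=> bf bg; rewrite -!RintegralZl// -RintegralD//; apply: le_Rintegral => // x _.
rewrite -subr_ge0 (_ : _ - _ = (f x - g x) ^+ 2) ?sqr_ge0//; ring.
Qed.

Lemma L2_closureD f g : bmfun f -> bmfun g -> L2_closure f -> L2_closure g ->
  L2_closure (fun x => f x + g x).
Proof.
move=> bf bg clf clg e e0; have e4 : 0 < e / 4 by lra.
have [f' Gf' ff'] := clf _ e4; have [g' Gg' gg'] := clg _ e4.
have bf' := lspan_bmfun Gf'; have bg' := lspan_bmfun Gg'.
exists (fun x => f' x + g' x); first exact: lspanD.
under eq_Rintegral do rewrite opprD addrACA.
have bff' : bmfun (fun x => f x - f' x) by [].
have bgg' : bmfun (fun x => g x - g' x) by [].
by apply: le_trans (Rintegral_sqrD_le bff' bgg') _; lra.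
Qed.

Lemma L2_closure_limit f : bmfun f ->
  (forall e : R, 0 < e -> exists f', [/\ bmfun f', L2_closure f' &
     \int[M]_x ((f x - f' x) ^+ 2) <= e]) -> L2_closure f.
Proof.
move=> bf lim_f e e0; have e4 : 0 < e / 4 by lra.
have [f' [bf' clf' ff']] := lim_f _ e4; have [g Gg f'g] := clf' _ e4.
have bg := lspan_bmfun Gg; exists g => //.
under eq_Rintegral => x _ do rewrite -(subrK (f' x) (f x)) -addrA.
have bff' : bmfun (fun x => f x - f' x) by [].
have bf'g : bmfun (fun x => f' x - g x) by [].
by apply: le_trans (Rintegral_sqrD_le bff' bf'g) _; lra.
Qed.

Lemma Rintegral_sqr_indicB B C : measurable B -> measurable C -> B `<=` C ->
  \int[M]_x ((\1_C x - \1_B x) ^+ 2) = pr M C - pr M B.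
Proof.
move=> mB mC BC; rewrite -!Rintegral_indic// -RintegralB//.
apply: eq_Rintegral => x _.
by case: (indicP B x) => [/BC|] Bx; case: indicP => // Cx; ring.
Qed.

Hypotheses (GI : setI_closed G) (GT : G setT).

Lemma L2_closure_setC B : L2_closure \1_B -> L2_closure \1_(~` B).
Proof.
move=> clB e /clB[g Gg Bg]; exists (fun x => 1 - g x).
  by apply: lspanB => //; exact: lspan_cst.
apply: le_trans Bg; rewrite le_eqVlt; apply/orP; left; apply/eqP.
by apply: eq_Rintegral => x _; rewrite indic_setC; ring.
Qed.

Lemma L2_closure_bigcup (B : (set Y)^nat) : (forall n, measurable (B n)) ->
  trivIset setT B -> (forall n, L2_closure \1_(B n)) ->
  L2_closure \1_(\bigcup_n B n).
Proof.
move=> mB tB clB; pose U n := \big[setU/set0]_(k < n) B k.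
have mU n : measurable (U n) by exact: bigsetU_measurable.
have mUU : measurable (\bigcup_n B n) by exact: bigcupT_measurable.
have clU n : L2_closure \1_(U n).
  elim: n => [|n IH].
    rewrite /U big_ord0 indic0; apply: lspan_L2_closure; exact: lspan_cst.
  rewrite /U big_ord_recr/= (_ : \1_(_) = fun x => \1_(U n) x + \1_(B n) x).
    by apply: L2_closureD => //; exact: bmfun_indic.
  apply/funext => x; apply: indic_setU_disjoint.
  rewrite /U (@trivIset_bigsetUI _ xpredT)//; apply: sub_trivIset tB.
  exact: subsetT.
apply: L2_closure_limit => [|e e0]; first exact: bmfun_indic.
have UE : \bigcup_n U n = \bigcup_n B n.
  apply/seteqP; split=> x [n _].
    by rewrite /U -bigcup_mkord => -[k _ Bk]; exists k.
  by move=> Bn; exists n.+1 => //; rewrite /U -bigcup_mkord; exists n => //=.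
have ndU : nondecreasing_seq U.
  apply/nondecreasing_seqP => n; apply/subsetPset; rewrite /U big_ord_recr/=.
  exact: subsetUl.
have /cvgrPdist_le/(_ _ e0)[n _ /(_ n (leqnn n))/=] := pr_nondecreasing_cvg M mU ndU.
rewrite UE => /(le_trans (ler_norm _)) pr_tail.
exists \1_(U n); split=> //.
by rewrite Rintegral_sqr_indicB// -UE; exact: bigcup_sup.
Qed.

Lemma L2_closure_measurable B :
  @measurable _ Y = <<s G >> -> measurable B -> L2_closure \1_B.
Proof.
move=> GE; rewrite GE; move: B.
apply: (dynkin_induction (P := fun B => L2_closure \1_B)) => //.
- by apply: lspan_L2_closure; exact: lspan_indic.
- by move=> B GB; apply: lspan_L2_closure; exact: lspan_indic.
- by move=> B mB; exact: L2_closure_setC.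
- exact: L2_closure_bigcup.
Qed.

End L2_closure.

(** * Continuity sets *)

Lemma exists_null_level {R : realType} {d : measure_display}
    {Y : measurableType d} (m : probability Y R) (u : Y -> R) (a b : R) :
  measurable_fun setT u -> a < b ->
  exists2 r, a < r < b & pr m (u @^-1` [set r]) = 0.
Proof.
move=> mu ab; apply: contrapT => no_null.
have : countable (`]a, b[%classic : set R).
  apply: sub_countable (pmf_gt0_countable (mfun_Sub (mem_set mu) : {RV m >-> R})).
  apply: subset_card_le => r /=; rewrite in_itv/= => rab.
  rewrite lt_neqAle pr_ge0 andbT eq_sym; apply/eqP => r0.
  by apply: no_null; exists r.
move=> /countable_lebesgue_measure0; rewrite lebesgue_measure_itv/= lte_fin ab.
by rewrite -EFinB => /eqP; rewrite eqe subr_eq0 gt_eqF.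
Qed.

Section boundary.
Context {F : topologicalType}.
Implicit Types B C : set F.

Lemma boundaryC B : boundary (~` B) = boundary B.
Proof. by rewrite /boundary closure_setC interiorC !setDE setCK setIC. Qed.

Lemma boundaryI B C : boundary (B `&` C) `<=` boundary B `|` boundary C.
Proof.
move=> x [cl it]; have clB : closure B x by apply: closureS cl; exact: subIsetl.
have clC : closure C x by apply: closureS cl; exact: subIsetr.
have [iB|] := pselect (interior B x); last by left.
by have [iC|] := pselect (interior C x); [case: it; rewrite interiorI|right].
Qed.

Lemma boundary_setT : boundary [set: F] = set0.
Proof. by rewrite /boundary closureT interiorT setDv. Qed.

Lemma closure_subU_boundary B : closure B `<=` B `|` boundary B.
Proof.
move=> x cx; have [Bx|Bx] := pselect (B x); first by left.
by right; split => // /interior_subset.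
Qed.

Lemma boundary_lt_set {R : realType} (u : F -> R) (r : R) : continuous u ->
  boundary [set y | u y < r] `<=` u @^-1` [set r].
Proof.
move=> cu y [cy iy]; apply/eqP; rewrite eq_le; apply/andP; split.
  have cl : closed [set y | u y <= r].
    by have /continuous_closedP/(_ _ (@closed_le _ r)) := cu.
  have : closure [set y | u y < r] `<=` [set y | u y <= r]; last exact.
  by rewrite [X in _ `<=` X](closure_id _).1//; apply: closureS => z /= /ltW.
have oC : open [set y | u y < r] by have /continuousP/(_ _ (@open_lt _ r)) := cu.
by rewrite leNgt; apply/negP => h; apply: iy; exact: open_nbhs_nbhs.
Qed.

End boundary.

Lemma measurable_open {F : ptopologicalType} (U : set F) :
  open U -> measurable (U : set (borelT F)).
Proof. by move=> oU; exact: sub_gen_smallest. Qed.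

Lemma measurable_generator {F : ptopologicalType} (G : set (set F)) :
  <<s G >> = <<s @open F >> -> G `<=` (measurable : set (set (borelT F))).
Proof.
move=> GE B GB; rewrite -[measurable _]/(<<s @open F >> B) -GE.
exact: sub_gen_smallest.
Qed.

Lemma measurable_closed {F : ptopologicalType} (U : set F) :
  closed U -> measurable (U : set (borelT F)).
Proof.
move=> cU; rewrite -[U]setCK; apply: measurableC; apply: measurable_open.
by rewrite openC.
Qed.

Lemma measurable_boundary {F : ptopologicalType} (B : set F) :
  measurable (boundary B : set (borelT F)).
Proof.
apply: measurableD; [apply: measurable_closed; exact: closed_closure|].
by apply: measurable_open; exact: open_interior.
Qed.

Definition continuity_set {R : realType} {F : ptopologicalType}
    (M : set F -> \bar R) : set (set F) :=
  [set B | measurable (B : set (borelT F)) /\ M (boundary B) = 0%E].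

Section continuity_set.
Context {R : realType} {F : ptopologicalType} (M : probability (borelT F) R).
Implicit Types B C : set F.

Lemma continuity_setC B : continuity_set M B -> continuity_set M (~` B).
Proof. by move=> [mB B0]; split; [exact: measurableC|rewrite boundaryC]. Qed.

Lemma continuity_setI : setI_closed (continuity_set M).
Proof.
move=> B C [mB B0] [mC C0]; split; first exact: measurableI.
have mb := @measurable_boundary F.
apply: (subset_measure0 (B := boundary B `|` boundary C : set (borelT F))) => //.
- exact: boundaryI.
- exact: null_set_setU.
Qed.

Lemma continuity_setT : continuity_set M setT.
Proof. by split; [exact: measurableT|rewrite boundary_setT measure0]. Qed.

Lemma lspan_continuity_set_bmfun (f : F -> R) :
  lspan (continuity_set M) f -> bmfun (f : borelT F -> R).
Proof. by apply: (@lspan_bmfun _ _ (borelT F)) => B []. Qed.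

Lemma pr_closure B : continuity_set M B -> pr M (closure B) = pr M B.
Proof.
move=> [mB B0]; have mb := measurable_boundary B.
have mcl : measurable (closure B : set (borelT F)).
  by apply: measurable_closed; exact: closed_closure.
apply/eqP; rewrite eq_le; apply/andP; split; last first.
  by apply: le_pr => //; exact: subset_closure.
rewrite -[leRHS]addr0 -[0]/(fine (0 : \bar R)) -B0.
apply: le_trans (pr_setU_le M mB mb); apply: le_pr => //.
exact: closure_subU_boundary.
Qed.

End continuity_set.

Section pseudometric_continuity_set.
Context {R : realType} {F : pseudoPMetricType R} (M : probability (borelT F) R).

Lemma open_continuity_set_nbhs (x : F) (U : set F) : nbhs x U ->
  exists C : set F, [/\ open C, continuity_set M C, C x & C `<=` U].
Proof.
move=> Ux; have /(@uniform_separatorP _ R)[u [cu u01 ux uU]] :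
    uniform_separator [set x] (~` U°).
  by apply: (@point_uniform_separator R _ _ _ (open_closedC (open_interior U))); apply.
have [mu _] : bmfun (u : borelT F -> R).
  apply: continuous_bmfun => //; apply: bounded_fun01 => y.
  by have := u01 (u y) (imageT u y); rewrite /= in_itv.
have [r /andP[r0 r1] Mr] := exists_null_level M mu ltr01.
have oC : open [set y | u y < r] by have /continuousP/(_ _ (@open_lt _ r)) := cu.
exists [set y | u y < r]; split => //.
- split; first exact: measurable_open.
  have mr : measurable (u @^-1` [set r] : set (borelT F)).
    exact: measurable_funT_preimage.
  apply: (subset_measure0 (B := u @^-1` [set r] : set (borelT F))) => //.
  + exact: measurable_boundary.
  + exact: boundary_lt_set.
  + by rewrite [LHS](prE M mr) Mr.
- by rewrite /= (ux (u x))//; exists x.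
- move=> y /= uy; apply: interior_subset; apply: contrapT => Uy.
  have := uU (u y) (ex_intro2 _ _ y Uy erefl).
  by rewrite /= => uy1; move: uy; rewrite uy1; lra.
Qed.

End pseudometric_continuity_set.

(** * Weak convergence *)

Definition weakly_cvg {R : realType} {F : ptopologicalType}
    (m : nat -> probability (borelT F) R) (M : probability (borelT F) R) :=
  forall f : F -> R, continuous f -> bounded_fun f ->
    \int[m l]_x f x @[l --> \oo] --> \int[M]_x f x.

Section portmanteau.
Context {R : realType} {F : pseudoPMetricType R} (M : probability (borelT F) R).

Lemma closed_outer_regular (K : set F) (e : R) : closed K -> 0 < e ->
  exists U : set F, [/\ open U, K `<=` U & pr M U <= pr M K + e].
Proof.
move=> cK e0; pose U (n : nat) := \bigcup_(x in K) (ball x (n.+1%:R^-1 : R))°.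
have oU n : open (U n) by apply: bigcup_open => x _; exact: open_interior.
have KU n : K `<=` U n.
  by move=> x Kx; exists x => //; apply: nbhsx_ballx; rewrite invr_gt0.
have niU : nonincreasing_seq U.
  apply/nonincreasing_seqP => n; apply/subsetPset => x [y Ky yx]; exists y => //.
  apply: interiorS yx => z; apply: le_ball.
  by rewrite lef_pV2 ?posrE// ler_nat.
have IU : \bigcap_n U n = K.
  apply/seteqP; split=> y; last by move=> Ky n _; exact: KU.
  move=> Uy; rewrite (closure_id K).1// => B /nbhs_ballP[r /= r0 rB].
  have [n _ /(_ n (leqnn n))/= rn] := near_infty_natSinv_lt (PosNum r0).
  have [x Kx /interior_subset xy] := Uy n I.
  exists x; split => //; apply: rB; apply: ball_sym; apply: le_ball xy.
  exact: ltW.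
have mU n : measurable (U n : set (borelT F)) by exact: measurable_open.
have /cvgrPdist_le/(_ _ e0)[n _ /(_ n (leqnn n))/=] := pr_nonincreasing_cvg M mU niU.
rewrite IU distrC => /(le_trans (ler_norm _)) UK.
by exists (U n); split => //; lra.
Qed.

Lemma closed_upper_continuous (K : set F) (e : R) : closed K -> 0 < e ->
  exists f : F -> R, [/\ continuous f, forall x, 0 <= f x <= 1,
    forall x, K x -> f x = 1 & \int[M]_x f x <= pr M K + e].
Proof.
move=> cK e0; have [U [oU KU MU]] := closed_outer_regular cK e0.
have /(@uniform_separatorP _ R)[f [cf f01 fU fK]] : uniform_separator (~` U) K.
  apply: normal_uniform_separator => //; first exact: pseudometric_normal.
    by rewrite closedC.
  by rewrite setIC; apply/disjoints_subset; rewrite setCK.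
have {}f01 x : 0 <= f x <= 1.
  by have := f01 (f x) (imageT f x); rewrite /= in_itv.
have bf : bmfun (f : borelT F -> R).
  by apply: continuous_bmfun => //; exact: bounded_fun01.
have mU := measurable_open oU.
exists f; split => //; first by move=> x Kx; apply: fK; exists x.
apply: le_trans MU; rewrite -Rintegral_indic//; apply: le_Rintegral => // x _.
case: indicP => Ux; first by have /andP[] := f01 x.
by rewrite (fU (f x))//; exists x.
Qed.

Variable m : nat -> probability (borelT F) R.
Hypothesis mM : weakly_cvg m M.

Lemma weakly_cvg_closed (K : set F) (e : R) : closed K -> 0 < e ->
  \forall l \near \oo, pr (m l) K <= pr M K + e.
Proof.
move=> cK e0; have e2 : 0 < e / 2 by lra.
have [f [cf f01 fK Mf]] := closed_upper_continuous cK e2.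
have bf := bounded_fun01 f01; have mf := continuous_bmfun cf bf.
have mK := measurable_closed cK.
have /cvgrPdist_le/(_ _ e2) := mM cf bf; apply: filterS => l.
rewrite distrC => /(le_trans (ler_norm _)) mf_le.
have Kf : pr (m l) K <= \int[m l]_x f x.
  rewrite -Rintegral_indic//; apply: le_Rintegral => // x _.
  by case: indicP => Kx; [rewrite fK|have /andP[] := f01 x].
by lra.
Qed.

Lemma weakly_cvg_continuity_set_le (C : set F) (e : R) :
  continuity_set M C -> 0 < e -> \forall l \near \oo, pr (m l) C <= pr M C + e.
Proof.
move=> cC e0; have clC := @closed_closure _ C.
have := weakly_cvg_closed clC e0; rewrite (pr_closure cC).
apply: filterS => l; apply: le_trans; apply: le_pr; first by case: cC.
  exact: measurable_closed.
exact: subset_closure.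
Qed.

Theorem weakly_cvg_continuity_set (C : set F) : continuity_set M C ->
  pr (m l) C @[l --> \oo] --> pr M C.
Proof.
move=> cC; have [mC _] := cC; apply/cvgrPdist_le => e e0.
have upper := weakly_cvg_continuity_set_le cC e0.
have := weakly_cvg_continuity_set_le (continuity_setC cC) e0.
apply: filterS2 upper => l upper; rewrite !pr_setC// ler_norml => lower.
by apply/andP; split; lra.
Qed.

Lemma weakly_cvg_lspan (f : F -> R) : lspan (continuity_set M) f ->
  \int[m l]_x f x @[l --> \oo] --> \int[M]_x f x.
Proof.
have bmf := @lspan_continuity_set_bmfun _ _ M; move=> Gf; apply/subr_cvg0.
apply: (lspan_cvg0 (Lam := fun l g => \int[m l]_x g x - \int[M]_x g x)) Gf.
  move=> l a b g h /bmf bg /bmf bh.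
  by rewrite !RintegralD// !RintegralZl//; ring.
move=> B cB; have [mB _] := cB; apply/subr_cvg0; rewrite Rintegral_indic//.
under eq_fun do rewrite Rintegral_indic//.
exact: weakly_cvg_continuity_set.
Qed.

End portmanteau.

(** * Rectangles in the sequence space *)

Definition rect {S : Type} (n : nat) (B : nat -> set S) : set (nat -> S) :=
  [set y | forall j, (j < n)%N -> B j (y j)].

Lemma rectS {S : Type} n (B : nat -> set S) (y : nat -> S) : rect n.+1 B y <->
  B 0%N (y 0%N) /\ rect n (fun j => B j.+1) (fun j => y j.+1).
Proof.
split=> [By|[B0 By] [|j]]; [|by []|exact: By].
by split=> [|j jn]; [exact: (By 0%N)|exact: (By j.+1)].
Qed.

Section ptws_nbhs.
Context {S : uniformType} (y : {ptws nat -> S}).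

Lemma nbhs_rect n (B : nat -> set S) :
  (forall j, nbhs (y j) (B j)) -> nbhs y (rect n B : set {ptws nat -> S}).
Proof.
move=> yB; have nbhs_y : Filter (nbhs y) := nbhs_filter y.
have proj t : (fun g : {ptws nat -> S} => g t) @ nbhs y --> y t.
  by move: t; apply/(pointwise_cvgP y nbhs_y); exact: cvg_id.
elim: n => [|n IH]; first by apply: filterS filterT => z _ j.
have Bn : nbhs y [set z : {ptws nat -> S} | B n (z n)] by exact: (proj n).
apply: filterS (filterI IH Bn) => z [/= Bz Bzn] j.
by rewrite ltnS leq_eqVlt => /predU1P[->//|]; exact: Bz.
Qed.

Lemma nbhs_ptws_rect (W : set {ptws nat -> S}) : nbhs y W ->
  exists n (B : nat -> set S), (forall j, nbhs (y j) (B j)) /\ rect n B `<=` W.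
Proof.
move=> yW; pose boxes : set_system {ptws nat -> S} := [set V |
  exists n (B : nat -> set S), (forall j, nbhs (y j) (B j)) /\ rect n B `<=` V].
have boxes_filter : Filter boxes.
  split.
  - by exists 0%N, (fun=> setT); split => // j; exact: filterT.
  - move=> V V' [n [B [nB BV]]] [n' [B' [nB' BV']]].
    exists (maxn n n'), (fun j => B j `&` B' j); split=> [j|z h].
      exact: filterI.
    split; [apply: BV|apply: BV'] => j jn;
      by have [] := h j; rewrite ?leq_max ?jn ?orbT.
  - by move=> V V' VV' [n [B [nB BV]]]; exists n, B; split => // z /BV /VV'.
suff : boxes --> y by apply.
apply/pointwise_cvgP => t U Ut.
exists t.+1, (fun j => if j == t then U else setT); split.
  by move=> j; case: eqVneq => [->//|_]; exact: filterT.
by move=> z /(_ t (ltnSn t)); rewrite eqxx.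
Qed.

End ptws_nbhs.

Lemma measurable_preimage_rect {F : ptopologicalType} {d : measure_display}
    {Y : measurableType d} (Z : Y -> nat -> F) n (B : nat -> set F) :
  (forall j, measurable_fun setT ((fun x => Z x j) : Y -> borelT F)) ->
  (forall j, measurable (B j : set (borelT F))) -> measurable (Z @^-1` rect n B).
Proof.
move=> mZ mB; rewrite (_ : Z @^-1` rect n B =
    \bigcap_(j in `I_n) ((fun x => Z x j) @^-1` B j)); last first.
  by apply/seteqP; split=> x Bx j; exact: Bx.
rewrite -[X in measurable X]setCK setC_bigcap; apply/measurableC.
apply: bigcup_measurable => j _; apply/measurableC.
exact: measurable_funT_preimage (mZ j) (mB j).
Qed.

Definition continuity_rects {R : realType} {F : ptopologicalType}
    (M : set F -> \bar R) : set (set (nat -> F)) :=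
  [set E | exists n B, (forall j, continuity_set M (B j)) /\ E = rect n B].

Section continuity_rects.
Context {R : realType} {F : pseudoPMetricType R} (M : probability (borelT F) R).

Lemma continuity_rectsT : continuity_rects M setT.
Proof.
exists 0%N, (fun=> setT); split=> [j|]; first exact: continuity_setT.
by apply/seteqP; split=> // y _ j.
Qed.

Lemma continuity_rectsI : setI_closed (continuity_rects M).
Proof.
move=> _ _ [n [B [cB ->]]] [m [C [cC ->]]].
exists (maxn n m), (fun j => (if (j < n)%N then B j else setT) `&`
  (if (j < m)%N then C j else setT)); split=> [j|].
  apply: continuity_setI; case: ifP => // _; exact: continuity_setT.
apply/seteqP; split=> y.
  by move=> [By Cy] j _; split; case: ifPn => // jn; [exact: By|exact: Cy].
by move=> h; split=> j jn; have [] := h j; rewrite ?leq_max ?jn ?orbT.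
Qed.

Lemma continuity_rects_nbhs (y : {ptws nat -> F}) (W : set {ptws nat -> F}) :
  nbhs y W -> exists V : set {ptws nat -> F},
    [/\ continuity_rects M V, nbhs y V & V `<=` W].
Proof.
move=> /nbhs_ptws_rect[n [B [yB BW]]].
have /choice[C hC] j := open_continuity_set_nbhs M (yB j).
exists (rect n C); split.
- by exists n, C; split=> // j; case: (hC j).
- apply: nbhs_rect => j; case: (hC j) => oC _ Cy _.
  exact: open_nbhs_nbhs.
- move=> z Cz; apply: BW => j jn; case: (hC j) => _ _ _; apply; exact: Cz.
Qed.

Hypothesis cptF : compact [set: F].

Lemma continuity_rects_uniform_dense (f : {ptws nat -> F} -> R) (e : R) :
  continuous f -> 0 < e ->
  exists2 g, lspan (continuity_rects M) g & forall y, `|f y - g y| <= e.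
Proof.
apply: (@lspan_uniform_dense R {ptws nat -> F}).
- have := @tychonoff nat (fun=> F) (fun=> setT) (fun=> cptF).
  by congr compact; apply/seteqP.
- exact: continuity_rectsI.
- exact: continuity_rectsT.
- exact: continuity_rects_nbhs.
Qed.

Section bmfun_process.
Context {d : measure_display} {Y : measurableType d} (Z : Y -> nat -> F).
Hypothesis mZ : forall j, measurable_fun setT ((fun x => Z x j) : Y -> borelT F).

Lemma bmfun_lspan_rects (g : (nat -> F) -> R) :
  lspan (continuity_rects M) g -> bmfun (fun x => g (Z x)).
Proof.
elim=> [_ [n [B [cB ->]]]|a b g1 g2 _ IH1 _ IH2]; last by [].
have mB j : measurable (B j : set (borelT F)) by case: (cB j).
exact: bmfun_indic (measurable_preimage_rect n mZ mB).
Qed.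

Lemma bmfun_continuous_process (f : {ptws nat -> F} -> R) :
  continuous f -> bmfun (fun x => f (Z x)).
Proof.
move=> cf; apply: bmfun_uniform_limit => e e0.
have [g Gg fg] := continuity_rects_uniform_dense cf e0.
by exists (fun x => g (Z x)) => //; exact: bmfun_lspan_rects.
Qed.

End bmfun_process.

Section cvg_continuity_rects.
Context {d d' : measure_display} {X : measurableType d} {Om : measurableType d'}
  (m : nat -> probability X R) (P : probability Om R)
  (Z : nat -> X -> nat -> F) (Y : Om -> nat -> F).
Hypothesis mZ : forall l j,
  measurable_fun setT ((fun x => Z l x j) : X -> borelT F).
Hypothesis mY : forall j, measurable_fun setT ((fun w => Y w j) : Om -> borelT F).
Hypothesis cvg_rect : forall n (B : nat -> set F),
  (forall j, continuity_set M (B j)) ->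
  pr (m l) (Z l @^-1` rect n B) @[l --> \oo] --> pr P (Y @^-1` rect n B).

Lemma cvg_lspan_rects (g : (nat -> F) -> R) : lspan (continuity_rects M) g ->
  \int[m l]_x g (Z l x) - \int[P]_w g (Y w) @[l --> \oo] --> (0 : R).
Proof.
apply: (lspan_cvg0
  (Lam := fun l g => \int[m l]_x g (Z l x) - \int[P]_w g (Y w))).
  move=> l a b g1 g2 G1 G2.
  have [bZ1 bZ2] := (bmfun_lspan_rects (mZ l) G1, bmfun_lspan_rects (mZ l) G2).
  have [bY1 bY2] := (bmfun_lspan_rects mY G1, bmfun_lspan_rects mY G2).
  by rewrite !RintegralD// !RintegralZl//; ring.
move=> _ [n [B [cB ->]]]; apply/subr_cvg0.
have mB j : measurable (B j : set (borelT F)) by case: (cB j).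
have mYB := measurable_preimage_rect n mY mB.
have mZB l := measurable_preimage_rect n (mZ l) mB.
rewrite (_ : \int[P]_w _ = pr P (Y @^-1` rect n B)); last first.
  by rewrite -Rintegral_indic.
rewrite (_ : (fun l => _) = (fun l => pr (m l) (Z l @^-1` rect n B))); last first.
  by apply/funext => l; rewrite -Rintegral_indic.
exact: cvg_rect.
Qed.

Theorem cvg_continuity_rects (f : {ptws nat -> F} -> R) : continuous f ->
  \int[m l]_x f (Z l x) @[l --> \oo] --> \int[P]_w f (Y w).
Proof.
move=> cf; apply/subr_cvg0; apply: cvg0_approx => e e0.
have e2 : 0 < e / 2 by lra.
have [g Gg fg] := continuity_rects_uniform_dense cf e2.
exists (fun l => \int[m l]_x g (Z l x) - \int[P]_w g (Y w)).
  exact: cvg_lspan_rects.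
apply: nearW => l.
have fgZ := dist_Rintegral_le (m l) (bmfun_continuous_process (mZ l) cf)
  (bmfun_lspan_rects (mZ l) Gg) (fun x => fg (Z l x)).
have fgY := dist_Rintegral_le P (bmfun_continuous_process mY cf)
  (bmfun_lspan_rects mY Gg) (fun w => fg (Y w)).
move: fgZ fgY; rewrite !ler_norml => /andP[? ?] /andP[? ?].
set v := \int[m l]_x g (Z l x) - _; have := ler_norm v; have := ler_norm (- v).
by rewrite normrN {1 3}/v => *; apply/andP; split; lra.
Qed.

End cvg_continuity_rects.

End continuity_rects.

(** * First returns and the induced map *)

Definition visits_io {X : Type} (T : X -> X) (A : set X) : set X :=
  [set x | forall k : nat, exists2 n, (k <= n)%N & A (iter n T x)].

Section returns.
Context {d : measure_display} {X : measurableType d} (T : X -> X) (A : set X).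
Implicit Types (x : X) (n k : nat).

Lemma ret_time_eq x n : (0 < n)%N -> A (iter n T x) ->
  (forall k, (0 < k < n)%N -> ~ A (iter k T x)) -> ret_time T A x = n.
Proof.
move=> n0 An An_first; rewrite /ret_time; case: pselect => [h|[]]; last first.
  by exists n; rewrite n0; apply/asboolP.
case: ex_minnP => m /andP[m0 /asboolP Am] m_min.
have : (m <= n)%N by apply: m_min; rewrite n0; exact/asboolP.
rewrite leq_eqVlt => /predU1P[//|mn].
by case: (An_first m); rewrite ?m0.
Qed.

Lemma ret_timeP x : (exists2 n, (0 < n)%N & A (iter n T x)) ->
  [/\ (0 < ret_time T A x)%N, A (induced_map T A x) &
      forall k, (0 < k < ret_time T A x)%N -> ~ A (iter k T x)].
Proof.
move=> [n n0 An]; rewrite /induced_map /ret_time.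
case: pselect => [h|[]]; last by exists n; rewrite n0; exact/asboolP.
case: ex_minnP => m /andP[m0 /asboolP Am] m_min; split => // k /andP[k0 km] Ak.
have : (m <= k)%N by apply: m_min; rewrite k0; exact/asboolP.
by rewrite leqNgt km.
Qed.

Lemma ret_time_eq0 x : ret_time T A x = 0%N <-> forall n, ~ A (iter n.+1 T x).
Proof.
split=> [r0 n An|nA].
  by have [] := @ret_timeP x; [exists n.+1|rewrite r0].
rewrite /ret_time; case: pselect => // returns.
by have [[|n] //= /asboolP/nA] := returns.
Qed.

Lemma ret_time_eqS x n : ret_time T A x = n.+1 <->
  A (iter n.+1 T x) /\ forall k, (0 < k < n.+1)%N -> ~ A (iter k T x).
Proof.
split=> [rn|[An An_first]]; last exact: ret_time_eq.
have : exists2 k, (0 < k)%N & A (iter k T x).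
  apply: contrapT => nA; suff : ret_time T A x = 0%N by rewrite rn.
  by apply/ret_time_eq0 => k Ak; apply: nA; exists k.+1.
by move=> /ret_timeP[_]; rewrite /induced_map rn.
Qed.

Lemma induced_map_in x : A (T x) -> induced_map T A x = T x.
Proof.
move=> ATx; rewrite /induced_map (@ret_time_eq x 1)//.
by case.
Qed.

Lemma visits_io_invariant : T @^-1` visits_io T A = visits_io T A.
Proof.
apply/seteqP; split=> x io k.
  by have [n kn An] := io k; exists n.+1; [exact: leqW|rewrite iterSr].
have [[//|n] kn An] := io k.+1.
by exists n => //; rewrite -iterSr.
Qed.

Lemma visits_io_iter n x : visits_io T A (iter n T x) <-> visits_io T A x.
Proof.
elim: n x => [//|n IH] x; rewrite iterSr IH.
by rewrite -[X in X <-> _]/((T @^-1` visits_io T A) x) visits_io_invariant.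
Qed.

Lemma visits_io_returns x : visits_io T A x ->
  exists2 n, (0 < n)%N & A (iter n T x).
Proof. exact. Qed.

Lemma visits_io_induced_map x :
  visits_io T A x -> visits_io T A (induced_map T A x).
Proof. by move=> io; apply/visits_io_iter. Qed.

Lemma induced_map_mem x : visits_io T A x -> A (induced_map T A x).
Proof. by move=> /visits_io_returns/ret_timeP[]. Qed.

Lemma induced_map_out x : visits_io T A x -> ~ A (T x) ->
  induced_map T A x = induced_map T A (T x).
Proof.
move=> /(visits_io_iter 1 x)/visits_io_returns/ret_timeP[r0 Ar Ar_first] nATx.
rewrite /induced_map (@ret_time_eq x (ret_time T A (T x)).+1) ?iterSr//.
case=> [//|[//|k]]; rewrite ltnS => /andP[_ kr].
by rewrite iterSr; exact: Ar_first.
Qed.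

Lemma induced_map_before_return tau x : visits_io T A x ->
  before_return T A tau x ->
  induced_map T A (iter (tau x) T x) = induced_map T A x.
Proof.
rewrite /before_return /=; move: (tau x) => t io.
elim: t => [//|t IH] before; rewrite -IH; last first.
  by move=> n /andP[n0 nt]; apply: before; rewrite n0 leqW.
rewrite iterS -induced_map_out//; first exact/visits_io_iter.
by rewrite -iterS; apply: before; rewrite ltnSn.
Qed.

Definition constant_until_return (E : set X) := forall tau x,
  before_return T A tau x -> E (iter (tau x) T x) <-> E x.

Lemma constant_until_return_setY E :
  constant_until_return E -> E `+` T @^-1` E `<=` T @^-1` A.
Proof.
move=> constE; have shift x : ~ A (T x) -> E (T x) <-> E x.
  by move=> nATx; apply: (constE (fun=> 1%N)) => -[|[|n]].
move=> x [[Ex nETx]|[ETx nEx]]; apply: contrapT => /shift ET_E.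
  by apply: nETx; exact/ET_E.
by apply: nEx; exact/ET_E.
Qed.

Lemma local_processE {S : Type} (psi : X -> S) x :
  local_process T A psi x = local_process0 T A psi (induced_map T A x).
Proof. by apply/funext => j; rewrite /local_process iterSr. Qed.

Lemma local_process_rectS {S : Type} (psi : X -> S) n (B : nat -> set S) :
  visits_io T A `&` local_process T A psi @^-1` rect n.+1 B =
  induced_map T A @^-1` ((visits_io T A `&`
    local_process T A psi @^-1` rect n (fun j => B j.+1)) `&` psi @^-1` B 0%N).
Proof.
apply/seteqP; split=> x; rewrite /preimage/= rectS (local_processE psi x).
  by move=> [io [B0 Bn]]; do !split=> //; exact: visits_io_induced_map.
by move=> [[/visits_io_iter io Bn] B0].
Qed.

Lemma local_process0_restrict {S : pointedType} (psi : X -> S) x :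
  A x -> visits_io T A x ->
  local_process0 T A (psi \_ A) x = local_process0 T A psi x.
Proof.
move=> Ax io; have iterA j : A (iter j (induced_map T A) x) /\
    visits_io T A (iter j (induced_map T A) x).
  elim: j => [//|j [_ ioj]] /=.
  by split; [exact: induced_map_mem|exact: visits_io_induced_map].
apply/funext => j; rewrite /local_process0 patchE mem_set//.
by have [] := iterA j.
Qed.

Lemma local_process_restrict {S : pointedType} (psi : X -> S) x :
  visits_io T A x -> local_process T A (psi \_ A) x = local_process T A psi x.
Proof.
move=> io; rewrite !local_processE local_process0_restrict//.
  exact: induced_map_mem.
exact: visits_io_induced_map.
Qed.

Lemma local_process_constant_until_return {S : Type} (psi : X -> S)
    (E : set (nat -> S)) :
  constant_until_return (visits_io T A `&` local_process T A psi @^-1` E).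
Proof.
move=> tau x before; rewrite /preimage.
split=> -[/= io Ex].
  move/visits_io_iter in io; split=> //.
  by move: Ex; rewrite !local_processE induced_map_before_return.
split; first exact/visits_io_iter.
by rewrite /= !local_processE induced_map_before_return -?local_processE.
Qed.

End returns.

Lemma measurable_fun_nat {d : measure_display} {X : measurableType d}
    (tau : X -> nat) :
  (forall n, measurable (tau @^-1` [set n])) -> measurable_fun setT tau.
Proof.
move=> mtau _ B _; rewrite setTI (_ : _ @^-1` B = \bigcup_(n in B) tau @^-1` [set n]).
  exact: bigcup_measurable.
by apply/seteqP; split=> x; [move=> Bx; exists (tau x)|move=> [n Bn /= ->]].
Qed.

Section measurable_returns.
Context {d : measure_display} {X : measurableType d} (T : X -> X) (A : set X).
Hypotheses (mT : measurable_fun setT T) (mA : measurable A).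

Section stopped.
Variable tau : X -> nat.
Hypothesis mtau : measurable_fun setT tau.

Lemma measurable_stopped : measurable_fun setT (fun x => iter (tau x) T x).
Proof.
move=> _ B mB; rewrite setTI (_ : _ @^-1` B =
    \bigcup_n ((tau @^-1` [set n]) `&` (iter n T @^-1` B))).
  apply: bigcupT_measurable => n; apply: measurableI; last first.
    exact: measurable_iter_preimage.
  exact: measurable_funT_preimage.
apply/seteqP; split=> x /=; first by move=> Bx; exists (tau x).
by move=> [n _ [/= ->]].
Qed.

Lemma measurable_before_return : measurable (before_return T A tau).
Proof.
have -> : before_return T A tau = \bigcap_n
    ((tau @^-1` [set k | ~ (0 < n <= k)%N]) `|` ~` (iter n T @^-1` A)).
  apply/seteqP; split=> x before n => [_|n_le].
    by have [n_le|] := pselect (0 < n <= tau x)%N; [right; exact: before|left].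
  by case: (before n I).
apply: bigcapT_measurable => n; apply: measurableU.
  exact: measurable_funT_preimage.
by apply: measurableC; exact: measurable_iter_preimage.
Qed.

End stopped.

Lemma measurable_ret_time : measurable_fun setT (ret_time T A).
Proof.
apply: measurable_fun_nat => -[|n].
  rewrite (_ : _ @^-1` _ = \bigcap_n ~` (iter n.+1 T @^-1` A)).
    apply: bigcapT_measurable => n; apply: measurableC.
    exact: measurable_iter_preimage.
  apply/seteqP; split=> x; first by move=> /ret_time_eq0 nA n _; exact: nA.
  by move=> nA; apply/ret_time_eq0 => n; exact: nA.
rewrite (_ : _ @^-1` _ = (iter n.+1 T @^-1` A) `\`
    \bigcup_(k in [set k | (0 < k < n.+1)%N]) (iter k T @^-1` A)).
  apply: measurableD; first exact: measurable_iter_preimage.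
  by apply: bigcup_measurable => k _; exact: measurable_iter_preimage.
apply/seteqP; split=> x; first by move=> /ret_time_eqS[An nA]; split=> // -[k /nA].
by move=> [An nA]; apply/ret_time_eqS; split=> // k kn Ak; apply: nA; exists k.
Qed.

Lemma measurable_induced_map : measurable_fun setT (induced_map T A).
Proof. exact: (measurable_stopped measurable_ret_time). Qed.

Lemma measurable_visits_io : measurable (visits_io T A).
Proof.
have -> : visits_io T A =
    \bigcap_k \bigcup_(n in [set n | (k <= n)%N]) (iter n T @^-1` A).
  apply/seteqP; split=> x io k => [_|]; first by have [n kn An] := io k; exists n.
  by have [n kn An] := io k I; exists n.
apply: bigcapT_measurable => k; apply: bigcup_measurable => n _.
exact: measurable_iter_preimage.
Qed.

End measurable_returns.

Section induced_measure_preserving.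
Context {R : realType} {d : measure_display} {X : measurableType d}
  (mu : probability X R) (T : X -> X) (A : set X).
Hypotheses (mpT : measure_preserving mu T) (ergT : ergodic mu T).
Hypotheses (mA : measurable A) (A0 : 0 < pr mu A).

Let mT : measurable_fun setT T. Proof. by case: mpT. Qed.

Lemma pr_visits_io : pr mu (visits_io T A) = 1.
Proof.
have mV := measurable_visits_io mT mA.
have [|//] := pr_invariant ergT mV (@visits_io_invariant _ _ T A).
pose U k := \bigcup_(n in [set n | (k <= n)%N]) (iter n T @^-1` A).
have mU k : measurable (U k).
  by apply: bigcup_measurable => n _; exact: measurable_iter_preimage.
have UE k : U k = iter k T @^-1` U 0%N.
  apply/seteqP; split=> x [n kn An]; last first.
    by exists (n + k)%N; [exact: leq_addl|rewrite /preimage/= iterD].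
  by exists (n - k)%N => //; rewrite /preimage/= -iterD subnK.
have niU : nonincreasing_seq U.
  apply/nonincreasing_seqP => k; apply/subsetPset => x [n kn An].
  by exists n => //; exact: ltnW.
have := pr_nonincreasing_cvg mu mU niU.
rewrite (_ : \bigcap_k U k = visits_io T A); last first.
  apply/seteqP; split=> x io k; first by have [n kn An] := io k I; exists n.
  by move=> _; have [n kn An] := io k; exists n.
rewrite (_ : (fun k => pr mu (U k)) = fun=> pr mu (U 0%N)); last first.
  by apply/funext => k; rewrite UE pr_preimage_iter.
move=> /cvg_lim <-//; rewrite lim_cst// => U0.
have : pr mu A <= pr mu (U 0%N) by apply: le_pr => // x Ax; exists 0%N.
by rewrite U0 leNgt A0.
Qed.

(* The set [H] of the points that return to [A] in [B] is the preimage of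
   [(H \ A) U (A & B)], so that the masses of [H \ A] cancel. *)
Lemma pr_induced_map_preimage B : measurable B ->
  pr mu (A `&` induced_map T A @^-1` B) = pr mu (A `&` B).
Proof.
move=> mB; pose V := visits_io T A; pose H := V `&` induced_map T A @^-1` B.
have mV : measurable V := measurable_visits_io mT mA.
have mI := measurable_funT_preimage (measurable_induced_map mT mA) mB.
have HE : H = T @^-1` ((H `\` A) `|` (V `&` (A `&` B))).
  have VT x : V (T x) <-> V x := visits_io_iter T A 1 x.
  apply/seteqP; split=> x.
    move=> [Vx]; have [ATx|nATx] := pselect (A (T x)); rewrite /preimage/=.
      by rewrite induced_map_in// => Bx; right; split=> //; exact/VT.
    by rewrite induced_map_out// => Bx; left; split=> //; split=> //; exact/VT.
  move=> [[[/VT Vx Bx] nATx]|[/VT Vx [ATx Bx]]]; split=> //.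
    by rewrite /preimage/= induced_map_out.
  by rewrite /preimage/= induced_map_in.
have mH : measurable H by rewrite /H; auto with bmfun.
have splitH := pr_setDI mu mH mA.
have prHT : pr mu H = pr mu (H `\` A) + pr mu (A `&` B).
  rewrite {1}HE (pr_preimage mpT)// pr_setU//; last first.
    by apply/disj_set2P; rewrite -subset0 => x [[_ nAx] [_ [/nAx]]].
  by rewrite (pr_setI_full _ _ pr_visits_io).
have : pr mu (H `&` A) = pr mu (A `&` induced_map T A @^-1` B).
  by rewrite /H -setIA (pr_setI_full _ _ pr_visits_io)// setIC.
by move=> <-; lra.
Qed.

Theorem induced_map_measure_preserving :
  measure_preserving (conditional mu mA) (induced_map T A).
Proof.
have mI := measurable_induced_map mT mA; split=> // B mB.
have mIB := measurable_funT_preimage mI mB.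
by rewrite !conditionalE// pr_induced_map_preimage.
Qed.

End induced_measure_preserving.

(** * Asymptotic independence *)

Lemma ler_norm_RintegralM_sqr {R : realType} {d : measure_display}
    {X : measurableType d} (m : probability X R) (w f : X -> R) (r : R) :
  bmfun w -> bmfun f -> (forall x, `|w x| <= 1) -> 0 < r ->
  `|\int[m]_x (w x * f x)| <= r + r^-1 * \int[m]_x (f x ^+ 2).
Proof.
move=> bw bf w1 r0; rewrite -[X in _ <= X + _](Rintegral_prob_cst m).
rewrite -RintegralZl// -RintegralD//.
apply: le_trans (le_normr_Rintegral measurableT _) _ => //.
apply: le_Rintegral => // x _; rewrite normrM.
apply: (@le_trans _ _ `|f x|); first by rewrite ler_piMl.
rewrite -(ler_pM2l r0) mulrDr mulVKf ?gt_eqF// -real_normK ?num_real//.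
by have := normr_ge0 (f x); nra.
Qed.

Section weakly_cvg_uncorrelated.
Context {R : realType} {F : pseudoPMetricType R} (M : probability (borelT F) R)
  {d : measure_display} {X : measurableType d} (m : nat -> probability X R)
  (phi : nat -> X -> borelT F).
Hypothesis mphi : forall l, measurable_fun setT (phi l).

Let law l := distribution (m l) (mfun_Sub (mem_set (mphi l))).

Hypothesis lawM : weakly_cvg law M.

Let bmfun_phi l (f : F -> R) :
  bmfun (f : borelT F -> R) -> bmfun (fun x => f (phi l x)).
Proof. by move=> bf; exact: bmfun_comp bf (mphi l). Qed.

Lemma cvg_lspan_continuity_set (f : F -> R) : lspan (continuity_set M) f ->
  \int[m l]_x f (phi l x) @[l --> \oo] --> \int[M]_x f x.
Proof.
move=> Mf; have bf := lspan_continuity_set_bmfun Mf.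
rewrite (_ : (fun l => _) = (fun l => \int[law l]_x f x)).
  exact: weakly_cvg_lspan.
by apply/funext => l; apply/esym/(Rintegral_image (mphi l)).
Qed.

Lemma cvg_continuity_set (C : set F) : continuity_set M C ->
  pr (m l) (phi l @^-1` C) @[l --> \oo] --> pr M C.
Proof. exact: weakly_cvg_continuity_set lawM _. Qed.

Variables (W : nat -> X -> R) (G : set (set F)).
Hypotheses (bW : forall l, bmfun (W l)) (W1 : forall l x, `|W l x| <= 1).
Hypotheses (GM : G `<=` continuity_set M) (GT : G setT) (GI : setI_closed G).
Hypothesis GE : <<s G >> = <<s @open F >>.
Hypothesis uncorr : forall B, G B ->
  \int[m l]_x (W l x * \1_B (phi l x)) @[l --> \oo] --> (0 : R).

Let bmfun_lspanG (f : F -> R) : lspan G f -> bmfun (f : borelT F -> R).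
Proof. by move=> /(lspanS GM); exact: lspan_continuity_set_bmfun. Qed.

Lemma uncorrelated_lspan (g : F -> R) : lspan G g ->
  \int[m l]_x (W l x * g (phi l x)) @[l --> \oo] --> (0 : R).
Proof.
apply: (lspan_cvg0 (Lam := fun l f => \int[m l]_x (W l x * f (phi l x)))) => //.
move=> l a b f h /bmfun_lspanG/(bmfun_phi l) bf /bmfun_lspanG/(bmfun_phi l) bh.
rewrite -!RintegralZl// -?RintegralD//.
by apply: eq_Rintegral => x _; ring.
Qed.

(* [\1_C] is approximated by a combination [g] of indicators of [G]; squaring
   keeps [\1_C - g] among the combinations of continuity sets, so that its
   second moment under the law of [phi l] converges too. *)
Theorem weakly_cvg_uncorrelated (C : set F) : continuity_set M C ->
  \int[m l]_x (W l x * \1_C (phi l x)) @[l --> \oo] --> (0 : R).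
Proof.
move=> cC; have [mC _] := cC.
apply: cvg0_approx => e e0; pose r := e / 3; have r0 : 0 < r by rewrite divr_gt0.
have [g Gg Cg] : exists2 g : F -> R, lspan G g &
    \int[M]_x ((\1_C x - g x) ^+ 2) <= r ^+ 2.
  apply: (@L2_closure_measurable _ _ (borelT F) M G) mC _ _ => //.
  - by move=> B /GM[].
  - by rewrite exprn_gt0.
pose t x := \1_C x - g x : R.
have Mt : lspan (continuity_set M) t.
  by apply: lspanB; [exact: lspan_indic|exact: lspanS Gg].
have Mt2 : lspan (continuity_set M) (fun x => t x ^+ 2).
  under eq_fun do rewrite expr2.
  by apply: lspanM => //; exact: continuity_setI.
exists (fun l => \int[m l]_x (W l x * g (phi l x))); first exact: uncorrelated_lspan.
have Mt2r : \int[M]_x (t x ^+ 2) < 2 * r ^+ 2.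
  by apply: le_lt_trans Cg _; rewrite ltr_pMl ?ltr1n ?exprn_gt0.
apply: filterS (cvgr_le _ (cvg_lspan_continuity_set Mt2) _ Mt2r) => l le_t2.
have bg := bmfun_phi l (bmfun_lspanG Gg).
have bt := bmfun_phi l (lspan_continuity_set_bmfun Mt).
have bWt : bmfun (fun x => W l x * t (phi l x)) := bmfunM (bW l) bt.
have -> : \int[m l]_x (W l x * \1_C (phi l x)) =
    \int[m l]_x (W l x * g (phi l x)) + \int[m l]_x (W l x * t (phi l x)).
  by rewrite -RintegralD//; apply: eq_Rintegral => x _; rewrite /t; ring.
rewrite (le_trans (ler_normD _ _))// lerD2l.
apply: le_trans (ler_norm_RintegralM_sqr (m l) (bW l) bt (W1 l) r0) _.
have : r^-1 * \int[m l]_x (t (phi l x) ^+ 2) <= 2 * r.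
  by rewrite ler_pdivrMl// mulrCA -expr2.
by rewrite /r; lra.
Qed.

End weakly_cvg_uncorrelated.

(** * Local processes of rare events *)

Definition delayed_into_compact {R : realType} {d : measure_display}
    {X : measurableType d} (mu : set X -> \bar R) (T : X -> X)
    (A : nat -> set X) (lam : nat -> set X -> \bar R) : Prop :=
  exists2 K : set (set X -> \bar R), compactP mu K &
  exists nuF : nat -> set X -> \bar R, exists tau : nat -> X -> nat,
    [/\ forall l, Probs mu (nuF l),
        (fun l => dP (nuF l) (lam l)) @ \oo --> 0%E,
        forall l, measurable_fun setT (tau l),
        (fun l => nuF l (before_return T (A l) (tau l))) @ \oo --> 1%E &
        forall l, K (push T (tau l) (nuF l))].

Section delay.
Context {R : realType} {d : measure_display} {X : measurableType d}
  (mu : probability X R) (T : X -> X).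
Hypotheses (mpT : measure_preserving mu T) (ergT : ergodic mu T).

Let mT : measurable_fun setT T. Proof. by case: mpT. Qed.

Lemma dP_cvg0_pr (nu lam : nat -> set X -> \bar R) (E : nat -> set X) :
  (forall l, Probs mu (nu l)) -> (\forall l \near \oo, Probs mu (lam l)) ->
  (forall l, measurable (E l)) ->
  (fun l => dP (nu l) (lam l)) @ \oo --> 0%E ->
  pr (nu l) (E l) - pr (lam l) (E l) @[l --> \oo] --> (0 : R).
Proof.
move=> Pnu Plam mE nu_lam; apply/cvgr0Pnorm_lt => e e0.
have : \forall l \near \oo, (dP (nu l) (lam l) < e%:E)%E.
  by apply: (nu_lam [set x | (x < e%:E)%E]); apply: open_ereal_lt'; rewrite lte_fin.
by apply: filterS2 Plam => l Plam; exact: dist_pr_lt_dP.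
Qed.

Lemma dist_pr_push (nu : set X -> \bar R) (tau : X -> nat) (A E : set X) :
  Probs mu nu -> measurable_fun setT tau -> measurable A -> measurable E ->
  constant_until_return T A E ->
  `|pr nu E - pr (push T tau nu) E| <= 1 - pr nu (before_return T A tau).
Proof.
move=> /Probs_probability[p pE _] mtau mA mE constE.
have mbr := measurable_before_return mT mA mtau.
have mst := measurable_funT_preimage (measurable_stopped mT mtau) mE.
have -> : pr (push T tau nu) E = pr p ((fun x => iter (tau x) T x) @^-1` E).
  by rewrite /pr /push pE.
rewrite !(pr_eq pE)// -pr_setC//; apply: le_trans (dist_pr_setY p mE mst) _.
apply: le_pr => // x.
by move=> [[Ex nE]|[Ex nE]] /(constE tau x) EtauE; apply: nE; exact/EtauE.
Qed.

Variables A E : nat -> set X.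
Hypotheses (mA : forall l, measurable (A l)) (mE : forall l, measurable (E l)).
Hypothesis A_cvg0 : pr mu (A l) @[l --> \oo] --> (0 : R).
Hypothesis constE : forall l, constant_until_return T (A l) (E l).

Lemma constant_until_return_asymptotically_invariant :
  asymptotically_invariant mu T E.
Proof.
apply: (squeeze_cvgr _ (cvg_cst 0) A_cvg0); apply: nearW => l.
rewrite pr_ge0/=.
have mTE := measurable_funT_preimage mT (mE l).
have mTA := measurable_funT_preimage mT (mA l); have mEl := mE l.
rewrite -(pr_preimage mpT (mA l)); apply: le_pr => //.
exact: constant_until_return_setY.
Qed.

Theorem delayed_into_compact_cvg (lam : nat -> set X -> \bar R) :
  delayed_into_compact mu T A lam -> (\forall l \near \oo, Probs mu (lam l)) ->
  pr (lam l) (E l) - pr mu (E l) @[l --> \oo] --> (0 : R).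
Proof.
move=> [K cK [nuF [tau [PF dF mtau br1 KF]]]] Plam.
have push_mu : pr (push T (tau l) (nuF l)) (E l) - pr mu (E l)
    @[l --> \oo] --> (0 : R).
  apply: (compactP_cvg cK) => // p pmu.
  have invE := constant_until_return_asymptotically_invariant.
  exact: (asymptotically_invariant_dominated mpT ergT mE invE).
have nuF_push : pr (nuF l) (E l) - pr (push T (tau l) (nuF l)) (E l)
    @[l --> \oo] --> (0 : R).
  have br0 : 1 - pr (nuF l) (before_return T (A l) (tau l)) @[l --> \oo] --> (0 : R).
    rewrite -[0 in X in _ --> X](subrr 1); apply: cvgB; first exact: cvg_cst.
    exact: fine_cvg.
  apply: norm_cvg0; apply: (squeeze_cvgr _ (cvg_cst 0) br0); apply: nearW => l.
  by rewrite normr_ge0 dist_pr_push.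
have -> : (fun l => pr (lam l) (E l) - pr mu (E l)) =
    (fun l => (pr (push T (tau l) (nuF l)) (E l) - pr mu (E l)) +
      (pr (nuF l) (E l) - pr (push T (tau l) (nuF l)) (E l)) -
      (pr (nuF l) (E l) - pr (lam l) (E l))).
  by apply/funext => l; ring.
rewrite -[X in _ --> X]subr0 -[X in _ --> X - _]addr0.
exact: cvgB (cvgD push_mu nuF_push) (dP_cvg0_pr PF Plam mE dF).
Qed.

End delay.

Lemma dist_pr_setI_condm {R : realType} {d : measure_display} {X : measurableType d}
    (mu : probability X R) (nu lam : set X -> \bar R) (S E : set X) (c r : R) :
  Probs mu nu -> Probs mu lam -> measurable S -> measurable E -> 0 <= c <= 1 ->
  0 < pr nu S -> (dP nu lam < r%:E)%E ->
  `|pr lam (S `&` E) - c * pr lam S| <= `|pr (condm nu S) E - c| + (r + r).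
Proof.
move=> Pnu Plam mS mE /andP[c0 c1] S0 nu_lam; have mSE := measurableI _ _ mS mE.
have := dist_pr_lt_dP Pnu Plam mS nu_lam.
have := dist_pr_lt_dP Pnu Plam mSE nu_lam.
have S1 : pr nu S <= 1.
  by have [p pE _] := Probs_probability Pnu; rewrite (pr_eq pE mS) pr_le1.
rewrite (pr_condm Pnu)//; set v := _ - c.
have -> : pr nu (S `&` E) = pr nu S * (v + c).
  by rewrite subrK mulrA divff ?mul1r ?lt0r_neq0.
rewrite !ltr_norml => /andP[? ?] /andP[? ?]; rewrite ler_norml.
have := ler_norm v; have := ler_norm (- v); rewrite normrN => *.
by apply/andP; split; nra.
Qed.

Lemma Rintegral_centered_indic {R : realType} {d d' : measure_display}
    {X : measurableType d} {Y : measurableType d'} (m : probability X R)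
    (E : set X) (c : R) (phi : X -> Y) (B : set Y) :
  measurable_fun setT phi -> measurable E -> measurable B ->
  \int[m]_x ((\1_E x - c) * \1_B (phi x)) =
  pr m (E `&` phi @^-1` B) - c * pr m (phi @^-1` B).
Proof.
move=> mphi mE mB; have mphiB := measurable_funT_preimage mphi mB.
rewrite -!Rintegral_indic// -RintegralZl// -RintegralB//; apply: eq_Rintegral => x _.
by rewrite mulrBl indicI.
Qed.

Section delay_conditions.
Context {R : realType} {d : measure_display} {X : measurableType d}
  {S : Type} (mu : probability X R) (T : X -> X) (A : nat -> set X)
  (psi : nat -> X -> S) (M : set S -> \bar R) (G : set (set S)).

Definition exactly_delayed : Prop := forall B, G B -> (0 < M B)%E ->
  exists tau : nat -> X -> nat,
    (forall l, measurable_fun setT (tau l)) /\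
    ((fun l => condm (condm mu (A l)) (A l `&` psi l @^-1` B)
                 (before_return T (A l) (tau l))) @ \oo --> 1%E) /\
    exists2 K : set (set X -> \bar R), compactP mu K &
      forall l, K (push T (tau l)
                     (condm (condm mu (A l)) (A l `&` psi l @^-1` B))).

Definition approximately_delayed : Prop := forall eps : R, 0 < eps ->
  exists nu : nat -> set X -> \bar R,
    [/\ forall l, Probs mu (nu l),
        forall l, (dP (nu l) (condm mu (A l)) < eps%:E)%E &
        forall B, G B -> (0 < M B)%E -> delayed_into_compact mu T A
          (fun l => condm (nu l) (A l `&` psi l @^-1` B))].

Hypotheses (mA : forall l, measurable (A l)) (A0 : forall l, 0 < pr mu (A l)).
Hypothesis mpsi : forall l B, G B -> measurable (A l `&` psi l @^-1` B).

Lemma exactly_delayed_approximately : exactly_delayed -> approximately_delayed.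
Proof.
move=> delay eps eps0; have PA l : Probs mu (condm mu (A l)).
  exact: Probs_condm (Probs_self mu) (mA l) (A0 l).
exists (fun l => condm mu (A l)); split => // [l|B GB MB].
  by rewrite (dPxx (PA l)) lte_fin.
have [tau [mtau [br1 [K cK KF]]]] := delay B GB MB.
(* [K] consists of probabilities, so the conditioning events are not null. *)
have PS l : Probs mu (condm (condm mu (A l)) (A l `&` psi l @^-1` B)).
  apply: Probs_condm (PA l) (mpsi l GB) _.
  have [p pE _] := Probs_probability (PA l).
  rewrite lt_neqAle (pr_eq pE (mpsi l GB)) pr_ge0 andbT eq_sym; apply/eqP => S0.
  have [_ _ _ /condm_neq0] := cK.1 _ (KF l).
  by rewrite (pE _ (mpsi l GB)) (prE p (mpsi l GB)) S0.
exists K => //; exists (fun l => condm (condm mu (A l)) (A l `&` psi l @^-1` B)), tau.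
split => //; rewrite (_ : (fun l => _) = (fun=> 0%E)); first exact: cvg_cst.
by apply/funext => l; rewrite (dPxx (PS l)).
Qed.

End delay_conditions.

Section local_processes.
Context {R : realType} {d : measure_display} {X : measurableType d}
  (mu : probability X R) (T : X -> X) {F : pseudoPMetricType R}
  (A : nat -> set X) (psi : nat -> X -> F) (M : probability (borelT F) R)
  (G : set (set F)).
Hypotheses (mpT : measure_preserving mu T) (ergT : ergodic mu T).
Hypotheses (mA : forall l, measurable (A l)) (A0 : forall l, 0 < pr mu (A l)).
Hypothesis A_cvg0 : pr mu (A l) @[l --> \oo] --> (0 : R).
Hypothesis mpsi : forall l, measurable_fun (A l) (psi l : X -> borelT F).
Hypothesis psi_cvg : forall f : F -> R, continuous f -> bounded_fun f ->
  (fun l => cond_int mu (A l) (fun x => f (psi l x))) @ \oo -->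
  (\int[M]_x (f x)%:E)%E.
Hypotheses (GT : G setT) (GI : setI_closed G) (GE : <<s G >> = <<s @open F >>).
Hypothesis G_boundary : forall B, G B -> M (boundary B) = 0%E.
Hypothesis delay : approximately_delayed mu T A psi M G.

Local Notation phi l := (psi l \_ (A l) : X -> borelT F).
Local Notation muA l := (conditional mu (mA l)).

Let mT : measurable_fun setT T. Proof. by case: mpT. Qed.

Let mphi l : measurable_fun setT (phi l).
Proof.
exact: (measurable_restrictT (psi l : X -> borelT F) (mA l)).1 (@mpsi l).
Qed.

Let mphiB l (B : set F) : measurable (B : set (borelT F)) ->
  measurable (phi l @^-1` B).
Proof. exact: measurable_funT_preimage (mphi l). Qed.

Lemma restrict_preimage l (B : set F) :
  A l `&` psi l @^-1` B = A l `&` phi l @^-1` B.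
Proof.
by apply/seteqP; split=> x [Ax Bx]; split=> //; move: Bx;
  rewrite /preimage/= patchE mem_set.
Qed.

Let mS l (B : set F) : measurable (B : set (borelT F)) ->
  measurable (A l `&` psi l @^-1` B).
Proof. by move=> /(mphiB l) mB; rewrite restrict_preimage; exact: measurableI. Qed.

Lemma G_continuity_set : G `<=` continuity_set M.
Proof.
move=> B GB; split; last exact: G_boundary.
exact: measurable_generator GE _ GB.
Qed.

Lemma distribution_local_weakly_cvg :
  weakly_cvg (fun l => distribution (muA l) (mfun_Sub (mem_set (mphi l)))) M.
Proof.
move=> f cf bf; have mf := continuous_bmfun cf bf.
have := psi_cvg cf bf.
have -> : (fun l => cond_int mu (A l) (fun x => f (psi l x))) =
    (fun l => (\int[muA l]_x f (phi l x))%:E).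
  apply/funext => l; apply: (cond_int_conditional _ _ measurableT) => //.
  - exact: pr_setT.
  - by move=> x Ax _; rewrite patchE mem_set.
  - exact: bmfun_comp mf (mphi l).
rewrite (integral_EFin_full (g := f : borelT F -> R) measurableT (pr_setT M))//.
move=> /fine_cvgP[_].
rewrite (_ : (fun l => _) = (fun l => \int[muA l]_x f (phi l x)))//.
by apply/funext => l; apply: (Rintegral_image (mphi l)).
Qed.

Lemma pr_conditional_phi_cvg (C : set F) : continuity_set M C ->
  pr (muA l) (phi l @^-1` C) @[l --> \oo] --> pr M C.
Proof. exact: cvg_continuity_set distribution_local_weakly_cvg _. Qed.

Section asymptotic_independence.
Variable E : nat -> set X.
Hypothesis mE : forall l, measurable (E l).
Hypothesis constE : forall l, constant_until_return T (A l) (E l).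

Let mEphi l (B : set F) : measurable (B : set (borelT F)) ->
  measurable (E l `&` phi l @^-1` B).
Proof. by move=> /(mphiB l); exact: measurableI. Qed.

Let prE01 l : 0 <= pr mu (E l) <= 1. Proof. by rewrite pr_ge0 pr_le1. Qed.

Lemma uncorrelated_null B : continuity_set M B -> pr M B = 0 ->
  pr (muA l) (E l `&` phi l @^-1` B) - pr mu (E l) * pr (muA l) (phi l @^-1` B)
    @[l --> \oo] --> (0 : R).
Proof.
move=> cB MB0; have := pr_conditional_phi_cvg cB; rewrite MB0 => muA0.
have [mB _] := cB; apply: norm_cvg0.
apply: (squeeze_cvgr _ (cvg_cst 0) muA0); apply: nearW => l; rewrite normr_ge0/=.
have EB : pr (muA l) (E l `&` phi l @^-1` B) <= pr (muA l) (phi l @^-1` B).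
  exact: le_pr (mEphi l mB) (mphiB l mB) _.
have := pr_ge0 (muA l) (E l `&` phi l @^-1` B).
by have /andP[] := prE01 l; rewrite ler_norml => *; apply/andP; split; nra.
Qed.

Lemma uncorrelated_delayed B : G B -> 0 < pr M B ->
  pr (muA l) (E l `&` phi l @^-1` B) - pr mu (E l) * pr (muA l) (phi l @^-1` B)
    @[l --> \oo] --> (0 : R).
Proof.
move=> GB MB0; have cB := G_continuity_set GB; have [mB _] := cB.
apply: cvg0_approx => e e0; pose r := Num.min (e / 2) (pr M B / 2).
have [re rM] : r <= e / 2 /\ r <= pr M B / 2 by rewrite !ge_min !lexx orbT.
have r0 : 0 < r by rewrite lt_min; apply/andP; split; lra.
have [nu [Pnu nuA nu_delay]] := delay r0.
have PA l := Probs_condm (Probs_self mu) (mA l) (A0 l).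
have prA l (D : set X) : measurable D ->
    pr (condm mu (A l)) (A l `&` D) = pr (muA l) D.
  move=> mD; rewrite (pr_eq (condm_conditional (mA l) (A0 l)))//.
  exact: pr_conditional_setI.
have prB l := prA l _ (mphiB l mB); have prEB l := prA l _ (mEphi l mB).
have MB : (0 < M B)%E by rewrite (prE M mB) lte_fin.
have nuE := delayed_into_compact_cvg mpT ergT mA mE A_cvg0 constE (nu_delay B GB MB).
have nuS : \forall l \near \oo, 0 < pr (nu l) (A l `&` psi l @^-1` B).
  have M2 : pr M B / 2 < pr M B by lra.
  apply: filterS (cvgr_ge _ (pr_conditional_phi_cvg cB) _ M2) => l.
  have := dist_pr_lt_dP (Pnu l) (PA l) (mS l mB) (nuA l).
  by rewrite restrict_preimage prB ltr_norml => /andP[]; lra.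
eexists; first apply: nuE.
  by apply: filterS nuS => l; exact: Probs_condm.
apply: filterS nuS => l nuSl.
have := dist_pr_setI_condm (Pnu l) (PA l) (mS l mB) (mE l) (prE01 l) nuSl (nuA l).
rewrite restrict_preimage -setIA (setIC _ (E l)) prB prEB => /le_trans.
by apply; lra.
Qed.

Lemma asymptotic_independence C : continuity_set M C ->
  pr (muA l) (E l `&` phi l @^-1` C) - pr mu (E l) * pr (muA l) (phi l @^-1` C)
    @[l --> \oo] --> (0 : R).
Proof.
move=> cC; pose W l x : R := \1_(E l) x - pr mu (E l).
have bW l : bmfun (W l) by exact: bmfunD (bmfun_indic (mE l)) (bmfun_cst _).
have W1 l x : `|W l x| <= 1.
  rewrite /W ler_norml; have [] := (pr_ge0 mu (E l), pr_le1 mu (mE l)).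
  by case: indicP => *; apply/andP; split; lra.
have WE (B : set F) : continuity_set M B ->
    (fun l => \int[muA l]_x (W l x * \1_B (phi l x))) =
    (fun l => pr (muA l) (E l `&` phi l @^-1` B) -
      pr mu (E l) * pr (muA l) (phi l @^-1` B)).
  by move=> [mB _]; apply/funext => l; exact: Rintegral_centered_indic.
rewrite -WE//; apply: (weakly_cvg_uncorrelated distribution_local_weakly_cvg bW W1
  G_continuity_set GT GI GE _ cC) => B GB.
have cB := G_continuity_set GB; rewrite WE//.
have [MB0|MB0] := eqVneq (pr M B) 0; first exact: uncorrelated_null.
by apply: uncorrelated_delayed => //; rewrite lt_neqAle eq_sym MB0 pr_ge0.
Qed.

End asymptotic_independence.

Let mI l : measurable_fun setT (induced_map T (A l)).
Proof. exact: measurable_induced_map. Qed.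

Let mlocal_process0 l j :
  measurable_fun setT ((fun x => local_process0 T (A l) (phi l) x j) : X -> borelT F).
Proof. exact: (measurableT_comp (mphi l) (measurable_iter (mI l) j)). Qed.

Let mlocal_process l j :
  measurable_fun setT ((fun x => local_process T (A l) (phi l) x j) : X -> borelT F).
Proof. exact: (measurableT_comp (mphi l) (measurable_iter (mI l) j.+1)). Qed.

Local Notation rect_event l n B :=
  (visits_io T (A l) `&` local_process T (A l) (phi l) @^-1` rect n B).

Section rectangles.
Variables (n : nat) (B : nat -> set F).
Hypothesis cB : forall j, continuity_set M (B j).

Let mB j : measurable (B j : set (borelT F)). Proof. by case: (cB j). Qed.

Let mvisits l : measurable (visits_io T (A l)).
Proof. exact: measurable_visits_io. Qed.

Let mrect l : measurable (local_process T (A l) (phi l) @^-1` rect n B).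
Proof. exact: (measurable_preimage_rect n (mlocal_process l) mB). Qed.

Lemma rect_event_asymptotic_independence (C : set F) : continuity_set M C ->
  pr (muA l) (rect_event l n B `&` phi l @^-1` C) -
    pr mu (rect_event l n B) * pr (muA l) (phi l @^-1` C) @[l --> \oo] --> (0 : R).
Proof.
apply: (asymptotic_independence (E := fun l => rect_event l n B)) => l.
  exact: measurableI.
exact: local_process_constant_until_return.
Qed.

Lemma pr_local_process_rect l :
  pr mu (local_process T (A l) (phi l) @^-1` rect n B) = pr mu (rect_event l n B).
Proof. by rewrite pr_setI_full ?pr_visits_io. Qed.

Lemma pr_local_process0_rect l :
  pr (muA l) (local_process0 T (A l) (phi l) @^-1` rect n B) =
  pr (muA l) (rect_event l n B).
Proof.
have mPsi0 := measurable_preimage_rect n (mlocal_process0 l) mB.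
have V1 : pr (muA l) (visits_io T (A l)) = 1.
  rewrite pr_conditional// setIC pr_setI_full ?pr_visits_io// mulVf//.
  exact: lt0r_neq0.
rewrite pr_setI_full//.
rewrite -(pr_preimage (induced_map_measure_preserving mpT ergT _ _))//.
by congr pr; apply/funext => x; rewrite /preimage/= local_processE.
Qed.

Lemma rect_event_conditional_cvg0 :
  pr (muA l) (rect_event l n B) - pr mu (rect_event l n B) @[l --> \oo] --> (0 : R).
Proof.
have := rect_event_asymptotic_independence (continuity_setT M).
rewrite (_ : (fun l => _) = fun l =>
  pr (muA l) (rect_event l n B) - pr mu (rect_event l n B))//.
by apply/funext => l; rewrite preimage_setT setIT pr_setT mulr1.
Qed.

End rectangles.

Lemma pr_rect_eventS l n (B : nat -> set F) : (forall j, continuity_set M (B j)) ->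
  pr (muA l) (rect_event l n.+1 B) =
  pr (muA l) (rect_event l n (fun j => B j.+1) `&` phi l @^-1` B 0%N).
Proof.
move=> cB; rewrite local_process_rectS.
rewrite (pr_preimage (induced_map_measure_preserving mpT ergT _ _))//.
have mB j : measurable (B j : set (borelT F)) by case: (cB j).
have mV := measurable_visits_io mT (mA l); have mB0 := mphiB l (mB 0%N).
have := measurable_preimage_rect n (mlocal_process l) (fun j => mB j.+1).
by move=> mBn; apply: measurableI => //; exact: measurableI.
Qed.

Lemma pr_rect_event_cvg n (B : nat -> set F) : (forall j, continuity_set M (B j)) ->
  pr mu (rect_event l n B) @[l --> \oo] --> \prod_(j < n) pr M (B j).
Proof.
elim: n B => [|n IH] B cB.
  rewrite big_ord0 (_ : (fun l => _) = fun=> 1); first exact: cvg_cst.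
  apply/funext => l; rewrite -(pr_visits_io mpT ergT (mA l) (A0 l)); congr pr.
  by apply/seteqP; split=> x; [case|split].
have cB' j := cB j.+1; rewrite big_ord_recl mulrC.
have phi0 := pr_conditional_phi_cvg (cB 0%N).
have indep0 := rect_event_asymptotic_independence n cB' (cB 0%N).
have cond0 := rect_event_conditional_cvg0 n.+1 cB.
rewrite -[X in _ --> X]subr0 -[X in _ --> X - _]add0r.
apply: cvg_trans (cvgB (cvgD indep0 (cvgM (IH _ cB') phi0)) cond0).
apply: near_eq_cvg; apply: nearW => l.
by rewrite !fctE pr_rect_eventS// subrK subKr.
Qed.

Section iid_limit.
Context {d' : measure_display} {Om : measurableType d'} (P : probability Om R)
  (Y : Om -> nat -> F).
Hypothesis mY : forall j, measurable_fun setT ((fun w => Y w j) : Om -> borelT F).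
Hypothesis prY : forall n (B : nat -> set F), (forall j, continuity_set M (B j)) ->
  pr P (Y @^-1` rect n B) = \prod_(j < n) pr M (B j).
Hypothesis cptF : compact [set: F].
Variable f : {ptws nat -> F} -> R.
Hypothesis cf : continuous f.

Let mvisits l : measurable (visits_io T (A l)).
Proof. exact: measurable_visits_io. Qed.

Let visits1 l : pr mu (visits_io T (A l)) = 1.
Proof. exact: pr_visits_io. Qed.

Lemma local_process0_cvg :
  \int[muA l]_x f (local_process0 T (A l) (phi l) x) @[l --> \oo] -->
  \int[P]_w f (Y w).
Proof.
apply: (cvg_continuity_rects cptF _ mY) => // n B cB; rewrite prY//.
have cond0 := rect_event_conditional_cvg0 n cB.
have prod_cvg := @pr_rect_event_cvg n B cB.
rewrite -[X in _ --> X]add0r; apply: cvg_trans (cvgD cond0 prod_cvg).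
apply: near_eq_cvg; apply: nearW => l.
by rewrite !fctE subrK pr_local_process0_rect.
Qed.

Lemma local_process_cvg :
  \int[mu]_x f (local_process T (A l) (phi l) x) @[l --> \oo] -->
  \int[P]_w f (Y w).
Proof.
apply: (cvg_continuity_rects cptF _ mY) => // n B cB; rewrite prY//.
by under eq_fun do rewrite pr_local_process_rect//; exact: pr_rect_event_cvg.
Qed.

Theorem local_processes_cvg :
  ((fun l => cond_int mu (A l) (fun x => f (local_process0 T (A l) (psi l) x)))
    @ \oo --> (\int[P]_w (f (Y w))%:E)%E) /\
  ((fun l => (\int[mu]_x (f (local_process T (A l) (psi l) x))%:E)%E)
    @ \oo --> (\int[P]_w (f (Y w))%:E)%E).
Proof.
rewrite (integral_EFin_full measurableT (pr_setT P) (g := fun w => f (Y w)))//;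
  last first.
  exact: bmfun_continuous_process.
split.
  rewrite (_ : (fun l => _) =
      fun l => (\int[muA l]_x f (local_process0 T (A l) (phi l) x))%:E).
    by apply: cvg_EFin; [exact: nearW|exact: local_process0_cvg].
  apply/funext => l; apply: (cond_int_conditional _ _ (mvisits l) (visits1 l)) => //.
    by move=> x Ax io; rewrite local_process0_restrict.
  exact: bmfun_continuous_process.
rewrite (_ : (fun l => _) =
    fun l => (\int[mu]_x f (local_process T (A l) (phi l) x))%:E).
  by apply: cvg_EFin; [exact: nearW|exact: local_process_cvg].
apply/funext => l; apply: (integral_EFin_full (mvisits l) (visits1 l)).
  by move=> x io; rewrite local_process_restrict.
exact: bmfun_continuous_process.
Qed.

End iid_limit.

End local_processes.

Lemma pr_iid_rect {R : realType} {F : ptopologicalType} {dO dO' : measure_display}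
    {Om : measurableType dO} {Om' : measurableType dO'} (P : probability Om R)
    (psi : Om -> F) (P' : probability Om' R) (Y : Om' -> nat -> F)
    n (B : nat -> set F) :
  iid_with_law_of P' Y P psi -> (forall j, measurable (B j : set (borelT F))) ->
  pr P' (Y @^-1` rect n B) = \prod_(j < n) pr P (psi @^-1` B j).
Proof.
move=> [mY lawY indY] mB; apply: EFin_inj; rewrite -prE; last first.
  exact: measurable_preimage_rect.
rewrite -(big_mkord xpredT (fun j => pr P (psi @^-1` B j))) /index_iota subn0.
rewrite (big_morph EFin (@EFinM R) erefl).
rewrite (_ : Y @^-1` rect n B = [set w | forall j, j \in iota 0 n -> B j (Y w j)]).
  rewrite indY ?iota_uniq//; apply: eq_bigr => j _.
  rewrite /pr -(lawY j)// fineK// fin_num_measure//.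
  exact: measurable_funT_preimage (mY j) (mB j).
by apply/seteqP; split=> w Bw j; have := Bw j; rewrite /= mem_iota.
Qed.

Theorem mainTheorem6
  (R : realType) (d : measure_display) (X : measurableType d)
  (mu : probability X R) (T : X -> X)
  (F : pseudoPMetricType R)
  (A : nat -> set X) (psiA : nat -> X -> F)
  (dO : measure_display) (Om : measurableType dO) (P : probability Om R)
  (psi : Om -> F)
  (Bpi : set (set F)) :
  (* (F, d_F) is a compact metric space *)
  hausdorff_space F -> compact [set: F] ->
  (* ergodic probability preserving system *)
  measure_preserving mu T -> ergodic mu T ->
  (* asymptotically rare sequence *)
  asymptotically_rare mu A ->
  (* local observables psi_{A_l} : A_l -> F, and the random element psi *)
  (forall l, measurable_fun (A l) (psiA l : X -> borelT F)) ->
  measurable_fun setT (psi : Om -> borelT F) ->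
  (* psi_{A_l} ==> psi under mu_{A_l} *)
  (forall f : F -> R, continuous f -> bounded_fun f ->
     (fun l => cond_int mu (A l) (fun x => f (psiA l x)))
       @ \oo --> (\int[P]_w (f (psi w))%:E)%E) ->
  (* Bpi is a pi-system generating the Borel sigma-algebra, F in Bpi *)
  Bpi setT -> setI_closed Bpi -> <<s Bpi >> = <<s @open F >> ->
  (* Pr[psi in boundary B] = 0 for B in Bpi *)
  (forall B, Bpi B -> P (psi @^-1` boundary B) = 0%E) ->
  let conclusion :=
    forall (dO' : measure_display) (Om' : measurableType dO')
      (P' : probability Om' R) (Ystar : Om' -> nat -> F),
      iid_with_law_of P' Ystar P psi ->
      forall f : {ptws nat -> F} -> R, continuous f -> bounded_fun f ->
        ((fun l => cond_int mu (A l)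
              (fun x => f (local_process0 T (A l) (psiA l) x)))
           @ \oo --> (\int[P']_w (f (Ystar w))%:E)%E) /\
        ((fun l => (\int[mu]_x (f (local_process T (A l) (psiA l) x))%:E)%E)
           @ \oo --> (\int[P']_w (f (Ystar w))%:E)%E) in
  (* first version: nu_l := mu_{A_l} *)
  ((forall B, Bpi B -> (0 < P (psi @^-1` B))%E ->
      exists tau : nat -> X -> nat,
        (forall l, measurable_fun setT (tau l)) /\
        ((fun l => condm (condm mu (A l)) (A l `&` psiA l @^-1` B)
                     (before_return T (A l) (tau l)))
           @ \oo --> 1%E) /\
        exists2 K : set (set X -> \bar R), compactP mu K &
          forall l, K (push T (tau l)
                         (condm (condm mu (A l)) (A l `&` psiA l @^-1` B))))
    -> conclusion)
  /\
  (* more general version *)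
  ((forall eps : R, 0 < eps ->
      exists nu : nat -> set X -> \bar R,
        [/\ forall l, Probs mu (nu l),
            forall l, (dP (nu l) (condm mu (A l)) < eps%:E)%E &
            forall B, Bpi B -> (0 < P (psi @^-1` B))%E ->
            exists2 K : set (set X -> \bar R), compactP mu K &
            exists nuF : nat -> set X -> \bar R,
            exists tau : nat -> X -> nat,
              [/\ forall l, Probs mu (nuF l),
                  (fun l => dP (nuF l) (condm (nu l) (A l `&` psiA l @^-1` B)))
                    @ \oo --> 0%E,
                  forall l, measurable_fun setT (tau l),
                  (fun l => nuF l (before_return T (A l) (tau l)))
                    @ \oo --> 1%E &
                  forall l, K (push T (tau l) (nuF l))]])
    -> conclusion).
Proof.
move=> _ cptF mpT ergT [mA [A_gt0 A_to0]] mpsiA mpsi psi_cvg GT GI GE G_boundary.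
move=> conclusion; pose M := distribution P (mfun_Sub (mem_set mpsi)).
have A0 l : 0 < pr mu (A l) by rewrite -lte_fin -prE.
have A_cvg0 : pr mu (A l) @[l --> \oo] --> (0 : R) by exact: fine_cvg.
have psi_cvgM (f : F -> R) : continuous f -> bounded_fun f ->
    (fun l => cond_int mu (A l) (fun x => f (psiA l x))) @ \oo -->
    (\int[M]_x (f x)%:E)%E.
  move=> cf bf; rewrite integral_bmfun_distribution; first exact: psi_cvg.
  exact: continuous_bmfun.
have general : approximately_delayed mu T A psiA M Bpi -> conclusion.
  move=> delay dO' Om' P' Y iidY f cf _; have [mY _ _] := iidY.
  have prY n (B : nat -> set F) : (forall j, continuity_set M (B j)) ->
      pr P' (Y @^-1` rect n B) = \prod_(j < n) pr M (B j).
    by move=> cB; apply: (pr_iid_rect n iidY) => j; case: (cB j).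
  exact: (local_processes_cvg mpT ergT mA A0 A_cvg0 mpsiA psi_cvgM GT GI GE
    G_boundary delay mY prY cptF cf).
split=> // delay; apply: general; apply: exactly_delayed_approximately delay => //.
by move=> l B /(measurable_generator GE); exact: mpsiA.
Qed.
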